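(* For every $S\in\mathsf{SVW}_{n,m}$ one has $P_{\mathsf{hecke}}(S)=\mathsf{tab}(\mathsf{rect}(S))$.
   Context: $[n]=\{1,\dots,n\}$, $\mathbf{e}_k$ standard basis of $\mathbb{Z}^n$. For a subset $T\subseteq[n]$ (possibly empty) let $\mathrm{wt}(T)=\sum_{j\in T}\mathbf{e}_j$ and for $i\in[n-1]$: $e_i(T)=T\cup\{i\}$ if $T\cap\{i,i+1\}=\{i+1\}$, $T\setminus\{i+1\}$ if $T\cap\{i,i+1\}=\{i,i+1\}$, else $0$; $f_i(T)=T\cup\{i+1\}$ if $T\cap\{i,i+1\}=\{i\}$, $T\setminus\{i\}$ if $T\cap\{i,i+1\}=\{i,i+1\}$, else $0$. Let $\varepsilon_i(b)=\sup\{k:e_i^k(b)\ne0\}$ and $\varphi_i(b)=\sup\{k:f_i^k(b)\ne 0\}$. Tensor products: weights add, $e_i(b\otimes c)=b\otimes e_i(c)$ if $\varepsilon_i(b)\le\varphi_i(c)$ else $e_i(b)\otimes c$, $f_i(b\otimes c)=b\otimes f_i(c)$ if $\varepsilon_i(b)<\varphi_i(c)$ else $f_i(b)\otimes c$, with $b\otimes0=0\otimes c=0$. $\mathsf{SVW}_{n,m}$ is the set of $m$-tuples $S=(S_1,\dots,S_m)$ of subsets of $[n]$, a $\sqrt{\mathfrak{gl}_n}$-crystal via $S\leftrightarrow S_1\otimes\cdots\otimes S_m$. Define $E_i(S)=e_i^{\varepsilon_i(S)}(S)$ and $\mathsf{rect}=(E_1E_2\cdots E_{n-1})\cdots(E_1E_2)(E_1)$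 (composition, rightmost first). $\mathsf{tab}(S)$ is the left-justified tableau (matrix coordinates) whose row $i$ lists the numbers $m+1-j$, over $j\in[m]$ with $i\in S_j$, in increasing order. Hecke insertion of a positive integer $x$ into an increasing tableau (Young-diagram shape, strictly increasing rows and columns): process columns from the first; to insert $x$ into a column, let $y$ be the smallest entry of the column with $x<y$; if no such $y$ exists, append $x$ at the bottom of the column if the result is an increasing tableau, otherwise leave it unchanged, and stop; if $y$ exists, replace $y$ by $x$ if the result is increasing, otherwise leave it unchanged, and in either case insert the bumped $y$ into the next column in the same way. For $i\in[n]$, if $j_1<\dots<j_k$ are the indices $j$ with $i\in S_j$, let $A_i$ be the word $(m+1-j_1)(m+1-j_2)\cdots(m+1-j_k)$, and let $A(S)=A_1A_2\cdots A_n$ (concatenation). $P_{\mathsf{hecke}}(S)$ is the tableau obtained by Hecke inserting the letters of $A(S)$ one at a time, left to right, starting from the empty tableau. *)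

(* Defs.v *)
From HB Require Import structures.
From mathcomp Require Import all_boot.

Set Implicit Arguments.
Unset Strict Implicit.
Unset Printing Implicit Defensive.

(* Letters, rows and columns are numbered from 0: the letter i of [n] is the
   element i - 1 of 'I_n, and the crystal index i of [n-1] is the element i - 1
   of 'I_n.-1.  The value 0 of a crystal operator is None. *)

Section StringLength.
Variables (B : finType) (g : B -> option B).

Definition iter_op (k : nat) (b : B) : option B := iter k (obind g) (Some b).

(* sup {k | g^k(b) <> 0}: the string starting at b is either infinite or has
   fewer than #|B| steps (string_lengthP).  The strings used below are finite
   because e_i and f_i change the weight strictly monotonically. *)
Definition string_length (b : B) : nat :=
  \max_(k < #|B| | iter_op k b != None) k.

Lemma iter_opD j k b c :
  iter_op j b = Some c -> iter_op (k + j) b = iter_op k c.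
Proof. by rewrite /iter_op iterD => ->. Qed.

Lemma iter_op_mono j k b : j <= k -> iter_op k b != None -> iter_op j b != None.
Proof.
move=> /subnK <-; rewrite /iter_op iterD; case: (iter j _ _) => // /negP[].
by elim: (k - j) => //= l /eqP ->.
Qed.

Lemma iter_op_card b :
  iter_op #|B| b != None -> forall k, iter_op k b != None.
Proof.
move=> bB.
pose x (k : 'I_#|B|.+1) : B := odflt b (iter_op k b).
have xE k : iter_op (val k) b = Some (x k).
  have := iter_op_mono (ltn_ord k : k <= #|B|) bB.
  by rewrite /x; case: iter_op.
have /injectivePn[i0 [j0 neq_ij xij]] : ~~ injectiveb x.
  apply/negP => /injectiveP /leq_card; by rewrite card_ord ltnn.
have [i [j [lt_ij {}xij]]] : exists i j : 'I_#|B|.+1, i < j /\ x i = x j.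
  case: (ltngtP i0 j0) => [lt|lt|/val_inj eq].
  - by exists i0, j0.
  - by exists j0, i0.
  - by rewrite eq eqxx in neq_ij.
have per k : iter_op (k + j) b = iter_op (k + i) b.
  by rewrite (iter_opD _ (xE j)) (iter_opD _ (xE i)) xij.
elim/ltn_ind => k IH; have [le_kB|lt_Bk] := leqP k #|B|.
  exact: iter_op_mono bB.
have le_jk : j <= k by apply: leq_trans (ltnW lt_Bk); rewrite -ltnS.
rewrite -(subnK le_jk) per; apply: IH.
by rewrite -{2}(subnK le_jk) ltn_add2l.
Qed.

Lemma string_lengthP b : (exists k, iter_op k b = None) ->
  forall k, (iter_op k b != None) = (k <= string_length b).
Proof.
move=> [K bK] k; apply/idP/idP => [bk|].
  have lt_kB : k < #|B|.
    rewrite ltnNge; apply/negP => le_Bk.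
    by have := iter_op_card (iter_op_mono le_Bk bk) K; rewrite bK.
  exact: (@leq_bigmax_cond _ _ (fun k : 'I_#|B| => k : nat) (Ordinal lt_kB)).
have B_gt0 : 0 < #|B| by apply/card_gt0P; exists b.
rewrite /string_length (bigop.bigmax_eq_arg (Ordinal B_gt0)) //.
by case: arg_maxnP => // j bj _ le_kj; apply: iter_op_mono le_kj bj.
Qed.

End StringLength.

(* The operators e_i (raise) and f_i (lower) for one fixed index i. *)
Record crystal_ops (B : Type) := CrystalOps {
  raise : B -> option B;
  lower : B -> option B
}.

Definition eps (B : finType) (u : crystal_ops B) : B -> nat :=
  string_length (raise u).

Definition phi (B : finType) (u : crystal_ops B) : B -> nat :=
  string_length (lower u).

Definition tensor (B C : finType) (u : crystal_ops B) (v : crystal_ops C) :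
    crystal_ops (B * C)%type :=
  {| raise p := if eps u p.1 <= phi v p.2
                then omap (fun c => (p.1, c)) (raise v p.2)
                else omap (fun b => (b, p.2)) (raise u p.1);
     lower p := if eps u p.1 < phi v p.2
                then omap (fun c => (p.1, c)) (lower v p.2)
                else omap (fun b => (b, p.2)) (lower u p.1) |}.

Section SetValuedWords.
Variable n : nat.
Implicit Types (i : 'I_n.-1) (T : {set 'I_n}).

(* The letters i and i+1; lift (letter i) i has value i.+1. *)
Definition letter i : 'I_n := widen_ord (leq_pred n) i.
Definition next_letter i : 'I_n := lift (letter i) i.

Definition set_ops i : crystal_ops {set 'I_n} :=
  let a := letter i in
  let b := next_letter i in
  {| raise T := if T :&: [set a; b] == [set b] then Some (a |: T)
                else if T :&: [set a; b] == [set a; b] then Some (T :\ b)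
                else None;
     lower T := if T :&: [set a; b] == [set a] then Some (b |: T)
                else if T :&: [set a; b] == [set a; b] then Some (T :\ a)
                else None |}.

Definition SVW (m : nat) : finType := m.-tuple {set 'I_n}.

(* S_1 (x) (S_2 (x) (... (x) S_m)); the empty tensor product is the crystal
   with one element and zero operators, a unit for the tensor product. *)
Fixpoint SVW_ops i (m : nat) : crystal_ops (SVW m) :=
  match m with
  | 0 => {| raise _ := None; lower _ := None |}
  | m'.+1 =>
    let u := tensor (set_ops i) (SVW_ops i m') in
    let split (S : m'.+1.-tuple {set 'I_n}) := (thead S, behead_tuple S) in
    let join (p : {set 'I_n} * m'.-tuple {set 'I_n}) : SVW m'.+1 :=
      cons_tuple p.1 p.2 in
    {| raise S := omap join (raise u (split S));
       lower S := omap join (lower u (split S)) |}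
  end.

Variable m : nat.
Implicit Type S : SVW m.

(* The default value of odflt is never used, as e_i^(eps_i(S))(S) <> 0. *)
Definition E i S : SVW m :=
  odflt S (iter_op (raise (SVW_ops i m)) (eps (SVW_ops i m) S) S).

(* E_1 E_2 ... E_k, where k is numbered from 0; E_k acts first. *)
Definition E_block (k : 'I_n.-1) S : SVW m :=
  foldr E S [seq i : 'I_n.-1 <- enum 'I_n.-1 | i <= k].

Definition rect S : SVW m :=
  foldl (fun U k => E_block k U) S (enum 'I_n.-1).

(* With j numbered from 0, the number m + 1 - j is m - j. *)
Definition row_word S (a : 'I_n) : seq nat :=
  [seq m - j | j : 'I_m <- enum 'I_m & a \in tnth S j].

(* A filling maps (row, column) to the entry, or None outside the shape. *)
Definition tab S (r c : nat) : option nat :=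
  onth (nth [::] [seq sort leq (row_word S a) | a <- enum 'I_n] r) c.

End SetValuedWords.

Section HeckeInsertion.

(* For insertion a tableau is the sequence of its columns, read from left to
   right, each column being read from top to bottom. *)
Implicit Type T : seq (seq nat).

Definition tableau_row T (r : nat) : seq nat :=
  [seq nth 0 C r | C <- T & r < size C].

Definition increasing_tableau T : bool :=
  [&& [::] \notin T,
      sorted geq (map size T),
      all (sorted ltn) T
    & all (fun r => sorted ltn (tableau_row T r)) (iota 0 (size (head [::] T)))].

(* Insert x into the first column of T, the columns in L being already
   processed; the whole tableau is L ++ T.  As columns increase, the smallest
   entry y > x of C is the topmost one. *)
Fixpoint hecke_insert_from L T (x : nat) : seq (seq nat) :=
  match T with
  | [::] =>
    let L' := rcons L [:: x] in if increasing_tableau L' then L' else L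
  | C :: T' =>
    let k := find (fun y => x < y) C in
    if k < size C then
      let C' := set_nth 0 C k x in
      hecke_insert_from
        (rcons L (if increasing_tableau (L ++ C' :: T') then C' else C))
        T' (nth 0 C k)
    else
      let U := L ++ rcons C x :: T' in
      if increasing_tableau U then U else L ++ C :: T'
  end.

Definition hecke_insert T (x : nat) : seq (seq nat) :=
  hecke_insert_from [::] T x.

Definition hecke_word n m (S : SVW n m) : seq nat :=
  flatten [seq row_word S a | a <- enum 'I_n].

Definition P_hecke n m (S : SVW n m) (r c : nat) : option nat :=
  onth (nth [::] (foldl hecke_insert [::] (hecke_word S)) c) r.

End HeckeInsertion.

(* Main.v *)
Require Import Defs.
From mathcomp Require Import all_boot zify.

Set Implicit Arguments.
Unset Strict Implicit.
Unset Printing Implicit Defensive.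

(* Scan the letters (values) 1, ..., m upwards.  On two rows i and i+1 the
   operator E_i is a transducer whose state is the number phi_i of unmatched
   brackets of the letters read so far.  Hecke insertion of a letter x commutes
   with restricting the tableau to the values <= v, so it is a scan as well: its
   state is the place where the insertion restricted to values <= v ends, namely
   a row together with the information whether a cell was added there.

   Rectifying k+1 rows, of which the first k already form a tableau, is one run
   of the chain E_1 ... E_k of transducers.  If x is smaller than all letters of
   the last row, adding x to that row changes the run as follows: at each value
   v exactly one of the counters is lowered, by 2 or by 1, and the row of this
   counter together with the amount (2 or 1) is the state of the scan inserting
   x into the output.  Hence inserting the letters of the last row in decreasing
   order computes the output of the chain, and induction on rows concludes. *)

(** * Hecke insertion as a walk through the columns *)

(** The strings of a single letter run through [{i+1}], [{i,i+1}] and [{i}], so they have length 2,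
    and over two rows that form a tableau the counter is twice the difference of the row lengths. A
    counter of at least 2 keeps an incoming lower letter in its row; a counter of 0 or 1 sends it
    up, for 1 with a copy left behind. Lowering an even positive counter by 1 or 2 can therefore
    divert a letter only if that counter is exactly 2, that is, if the row above is exactly one cell
    longer. On the side of Hecke insertion this is the case where the column to the right of the
    bumped entry is shorter, so that the entry has to leave its row. A loss of 2 reflects a cell
    added to the lower row; a loss of 1 arises when the letter sent up was already present in the
    row above, so that no cell is added. Rows below the event need not form a tableau; there it is
    enough that both runs agree. At the row of the event the counter is compared with the row
    lengths of the output, not of the input, and this keeps it even. *)

Definition col_adj (C D : seq nat) : bool :=
  (size D <= size C) && all (fun r => nth 0 C r < nth 0 D r) (iota 0 (size D)).

Lemma col_adjP C D :
  reflect (size D <= size C /\ forall r, r < size D -> nth 0 C r < nth 0 D r)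
          (col_adj C D).
Proof.
apply: (iffP andP) => -[le_DC adj]; split=> //.
  by move=> r ltr; apply: (allP adj); rewrite mem_iota.
by apply/allP=> r; rewrite mem_iota => /andP[_]; apply: adj.
Qed.

Lemma tableau_row_nil T r : all (fun C => size C <= r) T -> tableau_row T r = [::].
Proof.
rewrite /tableau_row; elim: T => //= C T IH /andP[le_Cr /IH].
by rewrite ltnNge le_Cr.
Qed.

(** Rows increase as soon as adjacent columns compare entry by entry. A change in one column then
    only concerns its two neighbours. *)
Lemma increasing_tableauE T :
  increasing_tableau T = [&& [::] \notin T, all (sorted ltn) T & sorted col_adj T].
Proof.
rewrite /increasing_tableau; congr andb; rewrite andbCA; congr andb.
elim: T => //= C [|D T] IH /=.
  by apply/allP => r; rewrite mem_iota /tableau_row /= => ->.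
rewrite -[path geq _ _]/(sorted geq (map size (D :: T))).
rewrite -[path col_adj _ _]/(sorted col_adj (D :: T)) -{}IH /=.
have [sorted_T|] := boolP (path geq _ _); last by rewrite !andbF.
rewrite !andbT /=.
have le_D r : size D <= r -> tableau_row (D :: T) r = [::].
  move=> le_Dr; apply: tableau_row_nil; rewrite /= le_Dr /=.
  have /allP geD : all (fun E => size E <= size D) T.
    move: sorted_T; rewrite (path_sortedE (leT := geq)); last first.
      by move=> a b c /= ab bc; apply: leq_trans bc ab.
    by rewrite all_map => /andP[].
  by apply/allP => E /geD /leq_trans; apply.
have rowE r : r < size C -> sorted ltn (tableau_row [:: C, D & T] r) =
    (r < size D) ==> (nth 0 C r < nth 0 D r) && sorted ltn (tableau_row (D :: T) r).
  rewrite /tableau_row /= => ->; have [ltrD //|leDr] := ltnP.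
  have := le_D r leDr; rewrite /tableau_row /= ltnNge leDr /= => -> //.
apply/andP/andP => [[le_DC /allP rows]|[/col_adjP[le_DC adj] /allP rows]].
  have rows' r : r < size D ->
      (nth 0 C r < nth 0 D r) && sorted ltn (tableau_row (D :: T) r).
    move=> ltr; have ltC := leq_trans ltr le_DC.
    by have := rows r; rewrite mem_iota rowE // ltr; apply.
  split; first by apply/col_adjP; split=> // r /rows' /andP[].
  by apply/allP => r; rewrite mem_iota => /andP[_ /rows' /andP[]].
split=> //; apply/allP => r; rewrite mem_iota => /andP[_ ltr].
rewrite rowE //; apply/implyP => ltD; rewrite adj //=.
by apply: rows; rewrite mem_iota.
Qed.

Lemma increasing_tableau_mid L C T : increasing_tableau (L ++ C :: T) =
  [&& increasing_tableau L, increasing_tableau T, C != [::], sorted ltn C,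
      (L == [::]) || col_adj (last [::] L) C & (T == [::]) || col_adj C (head [::] T)].
Proof.
rewrite !increasing_tableauE !mem_cat !inE !all_cat /= !negb_or.
rewrite ![[::] == C]eq_sym.
suff -> : sorted col_adj (L ++ C :: T) = [&& sorted col_adj L, sorted col_adj T,
   (L == [::]) || col_adj (last [::] L) C & (T == [::]) || col_adj C (head [::] T)].
  by do ![case: (_ \notin _)|case: (_ != _)|case: all|case: sorted]; rewrite ?andbF.
have pT : path col_adj C T =
    sorted col_adj T && ((T == [::]) || col_adj C (head [::] T)).
  by case: T => //= D T; rewrite andbC.
case: L => [|D L]; first by rewrite /= pT.
by rewrite /= cat_path /= pT; do ![case: path|case: sorted]; rewrite /= ?andbF.
Qed.

(* [w = (y, k, a)]: the value [y] enters a column after sitting in row [k] of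
   the column to its left, where it was overwritten iff [a]. *)
Definition replaces (C : seq nat) (w : nat * nat * bool) : bool :=
  (w.1.1 \notin C) && ((find (ltn w.1.1) C < w.1.2) || w.2).

(** [None] means that the insertion ended in an earlier column. The initial flag [true] stands for
    the missing left neighbour: in the first column only a repetition of [x] can block. *)
Fixpoint walk (T : nat -> seq nat) (x c : nat) : option (nat * nat * bool) :=
  if c is c'.+1 then
    if walk T x c' is Some w then
      let k := find (ltn w.1.1) (T c') in
      if k < size (T c') then Some (nth 0 (T c') k, k, replaces (T c') w) else None
    else None
  else Some (x, 0, true).

Definition walk_col (T : nat -> seq nat) (x c : nat) : seq nat :=
  if walk T x c is Some w then
    if replaces (T c) w then set_nth 0 (T c) (find (ltn w.1.1) (T c)) w.1.1 else T c
  else T c.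

Lemma sorted_ltn_nth C i j : sorted ltn C -> i < j -> j < size C -> nth 0 C i < nth 0 C j.
Proof.
move=> sC ij jC; apply: (sorted_ltn_nth ltn_trans 0 sC) => //; rewrite inE //.
exact: ltn_trans jC.
Qed.

Lemma sorted_ltnP C :
  reflect (forall i, i.+1 < size C -> nth 0 C i < nth 0 C i.+1) (sorted ltn C).
Proof. exact: (sortedP 0). Qed.

Lemma find_ltn_le C y i : i < find (ltn y) C -> nth 0 C i <= y.
Proof. by move/(before_find 0)=> /= /negbT; rewrite -leqNgt. Qed.

Lemma find_ltn_gt C y : find (ltn y) C < size C -> y < nth 0 C (find (ltn y) C).
Proof. by move=> lt; apply: (nth_find 0 (a := ltn y)); rewrite has_find. Qed.

(** If [y] occurs in [C], the search points just below it and writing [y] there repeats it;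
    otherwise [y] fits strictly between its new neighbours. *)
Lemma sorted_set_nth_find C y (k := find (ltn y) C) : sorted ltn C ->
  sorted ltn (set_nth 0 C k y) = (y \notin C).
Proof.
move=> sC; have lek : k <= size C by apply: find_size.
have le_y i : i < k -> nth 0 C i <= y by apply: find_ltn_le.
have gt_y : k < size C -> y < nth 0 C k by apply: find_ltn_gt.
move: k lek le_y gt_y => k lek le_y gt_y.
apply/sorted_ltnP/idP => [sC'|yC i].
  apply/negP => /(nthP 0)[i /= lti yi].
  have ltik : i < k.
    rewrite ltnNge; apply/negP => leki.
    have := gt_y (leq_ltn_trans leki lti); rewrite -yi.
    move: leki; rewrite leq_eqVlt => /orP[/eqP->|ltki]; first by rewrite ltnn.
    by have := sorted_ltn_nth sC ltki lti; lia.
  have ik : i = k.-1.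
    apply/eqP; case: (ltngtP i k.-1) => // [lt|]; last by lia.
    have lt1 : k.-1 < size C by lia.
    have lt2 : k.-1 < k by lia.
    by have := sorted_ltn_nth sC lt lt1; have := le_y _ lt2; lia.
  have := sC' i; rewrite size_set_nth !nth_set_nth /= (_ : i.+1 = k); last lia.
  rewrite eqxx ifF; last by apply/eqP; lia.
  by rewrite yi ltnn; move=> /(_ (leq_maxl _ _)).
rewrite size_set_nth !nth_set_nth /= => lti.
case: (eqVneq i.+1 k) => [ik|nik].
  rewrite ifF; last by apply/eqP; lia.
  have : nth 0 C i <= y by apply: le_y; lia.
  rewrite leq_eqVlt => /orP[/eqP yE|//].
  have ltiC : i < size C by lia.
  by case/negP: yC; rewrite -yE mem_nth.
case: (eqVneq i k) => [ik|nik']; last by apply: sorted_ltn_nth => //; lia.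
have ltkC : k < size C by lia.
apply: ltn_trans (gt_y ltkC) _; rewrite -ik.
by apply: sorted_ltn_nth => //; lia.
Qed.

(** The right neighbour imposes nothing: an overwritten entry only decreases, and an appended entry
    has no right neighbour because the next column is not longer. Distinctness in the column and the
    left neighbour remain. *)
Lemma increasing_set_nth L C T y (k := find (ltn y) C) :
  increasing_tableau L -> increasing_tableau T -> sorted ltn C ->
  (L == [::]) || col_adj (last [::] L) C ->
  (T == [::]) || col_adj C (head [::] T) ->
  (L != [::] -> k < size (last [::] L)) ->
  increasing_tableau (L ++ set_nth 0 C k y :: T) =
  (y \notin C) && ((L == [::]) || (nth 0 (last [::] L) k < y)).
Proof.
move=> incL incT sC LC CT ltkL; rewrite increasing_tableau_mid incL incT /=.
have -> : set_nth 0 C k y != [::] by rewrite -size_eq0 size_set_nth; lia.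
rewrite sorted_set_nth_find //=; congr andb.
have lek : k <= size C by apply: find_size.
have gt_y : k < size C -> y < nth 0 C k by apply: find_ltn_gt.
move: k ltkL lek gt_y => k ltkL lek gt_y.
have -> : (T == [::]) || col_adj (set_nth 0 C k y) (head [::] T).
  case/orP: CT => [->//|/col_adjP[le_TC adj]]; apply/orP; right.
  apply/col_adjP; split; first by rewrite size_set_nth; lia.
  move=> r ltr; rewrite nth_set_nth /=; case: eqP => [rk|_]; last exact: adj.
  rewrite rk; have ltkC : k < size C by lia.
  by apply: ltn_trans (gt_y ltkC) _; apply: adj; lia.
rewrite andbT; have [//|nL /=] := eqVneq L [::]; rewrite (negPf nL) /= in LC.
have {}ltkL := ltkL nL; case/col_adjP: LC => le_CL adj.
apply/col_adjP/idP => [[_ /(_ k)]|lt_y].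
  by rewrite size_set_nth nth_set_nth /= eqxx; apply; rewrite leq_maxl.
split; first by rewrite size_set_nth; lia.
move=> r; rewrite size_set_nth nth_set_nth /= => ltr.
by case: eqP => [->//|nr]; apply: adj; lia.
Qed.

Lemma walk_None T x c j : walk T x c = None -> c <= j -> walk T x j = None.
Proof.
move=> wc; elim: j => [|j IH]; first by rewrite leqn0 => /eqP <-.
by rewrite leq_eqVlt => /orP[/eqP <-//|/IH /= ->].
Qed.

Lemma walk_col_last T x c w j : walk T x c = Some w ->
  size (T c) <= find (ltn w.1.1) (T c) -> c < j -> walk_col T x j = T j.
Proof.
move=> wc le_find ltcj; rewrite /walk_col (walk_None (c := c.+1)) //=.
by rewrite wc ltnNge le_find.
Qed.

Lemma set_nth_size (C : seq nat) y : set_nth 0 C (size C) y = rcons C y.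
Proof. by elim: C => //= a C ->. Qed.

Lemma hecke_insert_from_walk T0 x T L y k a :
  drop (size L) T0 = T -> size L <= size T0 ->
  walk (nth [::] T0) x (size L) = Some (y, k, a) ->
  increasing_tableau (L ++ T) ->
  (forall j, j < size L -> nth [::] L j = walk_col (nth [::] T0) x j) ->
  (L = [::] -> a) ->
  (L != [::] -> [/\ k < size (last [::] L),
     forall i, i < k -> nth 0 (last [::] L) i < y,
     (nth 0 (last [::] L) k < y) = a &
     k < size (head [::] T) -> y < nth 0 (head [::] T) k]) ->
  increasing_tableau (hecke_insert_from L T y) /\
  forall j, nth [::] (hecke_insert_from L T y) j = walk_col (nth [::] T0) x j.
Proof.
elim: T L y k a => [|C T IH] L y k a dropT leL wL incLT colL aT leftL.
  have sT0 : size T0 = size L.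
    by apply/eqP; rewrite eqn_leq leL andbT -subn_eq0 -size_drop dropT.
  rewrite cats0 in incLT.
  have T0L : nth [::] T0 (size L) = [::] by rewrite nth_default ?sT0.
  have chk : increasing_tableau (rcons L [:: y]) = replaces [::] (y, k, a).
    rewrite -cats1 (@increasing_set_nth L [::] [::] y) //=.
    - rewrite /replaces /=; have [L0|nL] := eqVneq L [::]; first by rewrite aT ?orbT.
      by have [_ ltk <- _] := leftL nL; case: (k) ltk => [|k'] //= ->.
    - by apply/orP; right; apply/col_adjP.
    - by move=> /leftL[]; lia.
  have colL' : walk_col (nth [::] T0) x (size L) =
      if replaces [::] (y, k, a) then [:: y] else [::].
    by rewrite /walk_col wL T0L.
  have far j : size L < j -> walk_col (nth [::] T0) x j = [::].
    by move=> ltj; rewrite (walk_col_last wL) ?T0L // nth_default // sT0 ltnW.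
  rewrite /=; case: ifP => inc; split=> // j; rewrite -chk inc in colL'.
    rewrite nth_rcons; case: ltngtP => [ltj|ltj|->]; [exact: colL | |by []].
    by rewrite far.
  case: (ltngtP j (size L)) => [ltj|ltj|->]; first exact: colL.
    by rewrite far // nth_default // ltnW.
  by rewrite colL' nth_default.
have ltL : size L < size T0 by rewrite -subn_gt0 -size_drop dropT.
have T0L : nth [::] T0 (size L) = C.
  by rewrite -[size L]addn0 -nth_drop dropT.
have := incLT; rewrite increasing_tableau_mid => /and5P[incL incT nC sC /andP[LC CT]].
rewrite /=; set k' := find _ C.
have k'E : find (ltn y) C = k' by apply: eq_find.
have lek' : k' <= size C by apply: find_size.
have lek'k : L != [::] -> k' <= k.
  move=> /leftL[_ _ _ ltk]; have [/ltk/= lty|] := ltnP k (size C); last exact: leq_trans.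
  rewrite leqNgt; apply/negP; rewrite -k'E => /find_ltn_le; rewrite leqNgt.
  by rewrite lty.
have chk : increasing_tableau (L ++ set_nth 0 C k' y :: T) = replaces C (y, k, a).
  rewrite -k'E increasing_set_nth // k'E.
    rewrite /replaces /= k'E; congr andb.
    have [L0|nL] := eqVneq L [::]; first by rewrite aT ?orbT.
    have [_ ltk <- _] := leftL nL; have := lek'k nL; rewrite leq_eqVlt.
    by case/orP => [/eqP ->|lt]; [rewrite ltnn | rewrite lt ltk].
  by move=> nL; have [lt _ _ _] := leftL nL; exact: leq_ltn_trans (lek'k nL) lt.
have colL' : walk_col (nth [::] T0) x (size L) =
    if replaces C (y, k, a) then set_nth 0 C k' y else C.
  by rewrite /walk_col wL T0L /= k'E.
have dropT' : drop (size L).+1 T0 = T.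
  by rewrite -[RHS](drop0) -[T]/(behead (C :: T)) -dropT drop0 -drop1 drop_drop add1n.
have [ltk'|gek'] := ltnP; last first.
  have {gek'} k'C : k' = size C by apply/eqP; rewrite eqn_leq lek'.
  rewrite k'C set_nth_size in chk colL'.
  have far j : size L < j -> walk_col (nth [::] T0) x j = nth [::] T (j - size L).-1.
    move=> ltj; rewrite (walk_col_last wL) ?T0L //= ?k'E ?k'C // -dropT' nth_drop.
    by congr nth; clear -ltj; lia.
  case: ifP => inc; split=> // j; rewrite -chk inc in colL'; rewrite nth_cat.
    case: (ltngtP j (size L)) => [ltj|ltj|->]; first exact: colL.
      by rewrite far //; case: (j - size L) (subn_gt0 (size L) j) => //; rewrite ltj.
    by rewrite subnn colL'.
  case: (ltngtP j (size L)) => [ltj|ltj|->]; first exact: colL.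
    by rewrite far //; case: (j - size L) (subn_gt0 (size L) j) => //; rewrite ltj.
  by rewrite subnn colL'.
rewrite chk in colL' *.
apply: (IH _ _ k' (replaces C (y, k, a))); rewrite ?size_rcons //=.
- by rewrite wL T0L /= k'E ltk'.
- rewrite cat_rcons; case: ifP => // rep; by rewrite chk.
- move=> j; rewrite ltnS leq_eqVlt nth_rcons => /orP[/eqP->|ltj].
    by rewrite ltnn eqxx.
  by rewrite ltj colL.
- by move/(congr1 size); rewrite size_rcons.
move=> _; rewrite last_rcons.
have lty : y < nth 0 C k' by rewrite -k'E find_ltn_gt ?k'E.
split.
- by case: ifP; rewrite // size_set_nth leq_max ltnSn.
- move=> i lti; rewrite (fun_if (fun D => nth 0 D i)) nth_set_nth /=.
  by rewrite (ltn_eqF lti) if_same sorted_ltn_nth.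
- by case: ifP => _; rewrite ?nth_set_nth /= ?eqxx ?ltnn.
case/orP: CT => [/eqP -> //|/col_adjP[_ adj]]; exact: adj.
Qed.

Lemma hecke_insert_walk T x : increasing_tableau T ->
  increasing_tableau (hecke_insert T x) /\
  forall c, nth [::] (hecke_insert T x) c = walk_col (nth [::] T) x c.
Proof.
move=> incT.
by apply: (@hecke_insert_from_walk T x T [::] x 0 true) => //; rewrite drop0.
Qed.

(** * Fillings and their columns *)

(* [f v r] says that the value [v >= 1] occurs in row [r]. *)
Definition filling := nat -> nat -> bool.
Implicit Types f g : filling.

Fixpoint cnt f v r : nat := if v is v'.+1 then cnt f v' r + f v r else 0.

Fixpoint row f v r : seq nat :=
  if v is v'.+1 then if f v r then rcons (row f v' r) v else row f v' r else [::].

(** Built value by value: [v] goes below column [c] if it is the next entry of the row just under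
    that column. Restricting to smaller values is then the recursion itself, and [onth_col] shows
    agreement with the rows. *)
Fixpoint col f v c : seq nat :=
  if v is v'.+1 then
    let C := col f v' c in
    if f v (size C) && (cnt f v' (size C) == c) then rcons C v else C
  else [::].

Lemma cntS f v r : cnt f v.+1 r = cnt f v r + f v.+1 r.
Proof. by []. Qed.

(** A new cell in row [r.+1] must lie below a cell with a strictly smaller value; the same value may
    occur in several rows, as in any increasing tableau. *)
Definition is_tab f v : Prop :=
  forall u r, u < v -> f u.+1 r.+1 -> cnt f u r.+1 < cnt f u r.

Lemma is_tabW f u v : u <= v -> is_tab f v -> is_tab f u.
Proof. by move=> le_uv tf w r ltw; apply: tf; apply: leq_trans le_uv. Qed.

Lemma cnt_tab f v r : is_tab f v -> cnt f v r.+1 <= cnt f v r.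
Proof.
elim: v => //= v IH tf; have := IH (is_tabW (leqnSn v) tf).
by have := tf v r (ltnSn v); case: (f v.+1 r.+1) => [/(_ isT)|_]; lia.
Qed.

Lemma cnt_tab_le f v r s : is_tab f v -> r <= s -> cnt f v s <= cnt f v r.
Proof.
move=> tf /subnK <-; elim: (s - r) => //= k IH.
exact: leq_trans (cnt_tab _ tf) IH.
Qed.

Lemma eq_cnt f g v : (forall u r, 0 < u <= v -> f u r = g u r) -> cnt f v =1 cnt g v.
Proof.
elim: v => //= v IH fg r; rewrite fg ?leqnn // IH // => u s /andP[u0 leu].
by apply: fg; rewrite u0 leqW.
Qed.

Lemma eq_col f g v : (forall u r, 0 < u <= v -> f u r = g u r) -> col f v =1 col g v.
Proof.
elim: v => //= v IH fg c; have fg' u r : 0 < u <= v -> f u r = g u r.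
  by case/andP=> u0 leu; apply: fg; rewrite u0 leqW.
by rewrite IH // fg ?leqnn // (eq_cnt fg').
Qed.

Lemma col_le f v c : all (fun u => u <= v) (col f v c).
Proof.
elim: v => //= v IH; have IH' : all (fun u => u <= v.+1) (col f v c).
  by apply: sub_all IH => u; apply: leqW.
by case: ifP => // _; rewrite all_rcons leqnn.
Qed.

Lemma size_row f v r : size (row f v r) = cnt f v r.
Proof. by elim: v => //= v IH; case: (f v.+1 r); rewrite ?size_rcons IH ?addn1 ?addn0. Qed.

(** Conjugacy of row lengths and column heights, the dictionary between the two descriptions of a
    shape. *)
Lemma ltn_size_col f v c r : is_tab f v -> (r < size (col f v c)) = (c < cnt f v r).
Proof.
elim: v r => //= v IH r tf; have tf' := is_tabW (leqnSn v) tf.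
have {}IH s := IH s tf'.
set q := size (col f v c) in IH *.
have leq_q : cnt f v q <= c by rewrite leqNgt -IH ltnn.
have -> : size (if f v.+1 q && (cnt f v q == c) then rcons (col f v c) v.+1
                else col f v c) = q + (f v.+1 q && (cnt f v q == c)).
  by case: ifP; rewrite ?size_rcons -/q ?addn1 ?addn0.
case: (ltngtP r q) => [ltr|ltq|->]; first by have := IH r; lia.
  have le_r : cnt f v r <= cnt f v r.-1 <= cnt f v q.
    by rewrite !cnt_tab_le //; lia.
  have := tf v r.-1 (ltnSn v); rewrite prednK; last by lia.
  by case: (f v.+1 r) => [/(_ isT)|_]; lia.
lia.
Qed.

Lemma onth_rcons (T : Type) (s : seq T) x i :
  onth (rcons s x) i = if i == size s then Some x else onth s i.
Proof.
rewrite -cats1 onth_cat; case: ltngtP => // [lt|->]; last by rewrite subnn.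
have -> : onth s i = None by apply/onth_default/ltnW.
by rewrite onth_default //= subn_gt0.
Qed.

Lemma onth_col f v c r : is_tab f v -> onth (col f v c) r = onth (row f v r) c.
Proof.
elim: v => //= [|v IH] tf; first by rewrite !onth_default.
have tf' := is_tabW (leqnSn v) tf; have {}IH := IH tf'.
have szE s := @ltn_size_col f v c s tf'.
set q := size (col f v c) in szE *.
rewrite (fun_if (fun C => onth C r)) (fun_if (fun C => onth C c)) !onth_rcons.
rewrite -/q size_row -IH; case: (eqVneq r q) => [->|nrq].
  have -> : onth (col f v c) q = None by rewrite onth_default.
  by rewrite eq_sym; case: (f v.+1 q); case: eqP.
rewrite if_same; case: (boolP (f v.+1 r)) => // fr; case: eqVneq => // cr.
have ltr : ~~ (r < q) by rewrite szE -cr ltnn.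
have := tf v r.-1 (ltnSn v); rewrite prednK ?fr => [/(_ isT)|]; last by lia.
have := @cnt_tab_le f v q r.-1 tf'; have := szE q; lia.
Qed.

Definition in_col f v c : bool :=
  f v.+1 (size (col f v c)) && (cnt f v (size (col f v c)) == c).

Lemma size_colE f v c r : is_tab f v ->
  cnt f v r <= c -> (0 < r -> c < cnt f v r.-1) -> size (col f v c) = r.
Proof.
move=> tf le_c lt_c; apply/eqP; rewrite eqn_leq.
rewrite leqNgt ltn_size_col // -leqNgt le_c /=.
by case: r lt_c {le_c} => //= r lt_c; rewrite ltn_size_col // lt_c.
Qed.

Lemma size_col_cnt f v r : is_tab f v.+1 -> f v.+1 r -> size (col f v (cnt f v r)) = r.
Proof.
move=> tf fr; apply: size_colE => //; first exact: is_tabW tf.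
by case: r fr => //= r fr _; apply: tf.
Qed.

Lemma in_colP f v c : is_tab f v.+1 ->
  reflect (exists2 r, f v.+1 r & cnt f v r = c) (in_col f v c).
Proof.
move=> tf; apply: (iffP andP) => [[fr /eqP cE]|[r fr <-]].
  by exists (size (col f v c)).
by rewrite size_col_cnt ?eqxx.
Qed.

Lemma colS f v c : col f v.+1 c = if in_col f v c then rcons (col f v c) v.+1 else col f v c.
Proof. by []. Qed.

Lemma walkS T x c w (k := find (ltn w.1.1) (T c)) : walk T x c = Some w ->
  walk T x c.+1 =
  if k < size (T c) then Some (nth 0 (T c) k, k, replaces (T c) w) else None.
Proof. by rewrite /= => ->. Qed.

Definition stops (T : nat -> seq nat) x c a : Prop :=
  exists w, [/\ walk T x c = Some w, find (ltn w.1.1) (T c) = size (T c)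
              & replaces (T c) w = a].

Lemma find_ltn_rcons C y v : y < v -> find (ltn y) (rcons C v) = find (ltn y) C.
Proof.
move=> ltyv; rewrite -cats1 find_cat has_find /= ltyv addn0.
by case: ltnP => // ge; apply/eqP; rewrite eqn_leq ge find_size.
Qed.

Lemma replaces_rcons C w v : w.1.1 < v -> replaces (rcons C v) w = replaces C w.
Proof.
move=> lt; rewrite /replaces find_ltn_rcons // mem_rcons inE.
by rewrite (ltn_eqF lt).
Qed.

Lemma set_nth_rcons (C : seq nat) v k y : k < size C ->
  set_nth 0 (rcons C v) k y = rcons (set_nth 0 C k y) v.
Proof. by elim: C k => //= a C IH [|k] //= /IH ->. Qed.

Lemma find_ltn_max C y : all (fun u => u <= y) C -> find (ltn y) C = size C.
Proof. by elim: C => //= a C IH /andP[le /IH ->]; rewrite ltnNge le. Qed.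

(** * Insertion after a largest value has been added to some columns *)

Section AddMaximum.

Variables (T1 T2 : nat -> seq nat) (z : nat -> bool) (v : nat).
Hypothesis T1v : forall c, all (fun u => u < v) (T1 c).
Hypothesis T2E : forall c, T2 c = if z c then rcons (T1 c) v else T1 c.

Lemma add_max_le c : all (fun u => u <= v) (T2 c).
Proof.
have le1 : all (fun u => u <= v) (T1 c) by apply: sub_all (T1v c) => u /ltnW.
by rewrite T2E; case: (z c); rewrite ?all_rcons ?leqnn.
Qed.

Lemma find_add_max y c : y < v -> find (ltn y) (T2 c) = find (ltn y) (T1 c).
Proof. by move=> lt; rewrite T2E; case: (z c); rewrite ?find_ltn_rcons. Qed.

Lemma replaces_add_max w c : w.1.1 < v -> replaces (T2 c) w = replaces (T1 c) w.
Proof. by move=> lt; rewrite T2E; case: (z c); rewrite ?replaces_rcons. Qed.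

Lemma mem_add_max c : (v \in T2 c) = z c.
Proof.
have vT1 : v \notin T1 c by apply/negP => /(allP (T1v c)); rewrite ltnn.
by rewrite T2E; case: (z c); rewrite ?mem_rcons ?inE ?eqxx ?(negPf vT1).
Qed.

Lemma walk_max c : walk_col T2 v c = if (c == 0) then rcons (T1 0) v else T2 c.
Proof.
have w1 : walk T2 v 1 = None by rewrite /= find_ltn_max ?ltnn ?add_max_le.
case: c => [|c]; last by rewrite /walk_col (walk_None w1).
rewrite /walk_col /= /replaces /= find_ltn_max ?add_max_le // mem_add_max ?orbT andbT.
by rewrite T2E; case: (z 0); rewrite //= set_nth_size.
Qed.

Lemma stops_max : stops T2 v 0 (~~ z 0).
Proof.
exists (v, 0, true); split=> //=; first by rewrite find_ltn_max ?add_max_le.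
by rewrite /replaces /= ?orbT andbT mem_add_max.
Qed.

Variable x : nat.
Hypothesis ltxv : x < v.

Lemma walk_lt c w : walk T1 x c = Some w -> w.1.1 < v.
Proof.
case: c => [[<-]|c] //=; case: walk => // w' ; case: ifP => // lt [<-] /=.
by apply: (allP (T1v c)); rewrite mem_nth.
Qed.

Lemma walk_add_max c w : walk T1 x c = Some w -> walk T2 x c = Some w.
Proof.
elim: c w => //= c IH w; case wc: (walk T1 x c) => [w'|] //; case: ifP => // lt [<-].
have ltw := walk_lt wc; rewrite (IH _ wc) find_add_max // replaces_add_max //.
by rewrite T2E; case: (z c); rewrite ?lt // size_rcons nth_rcons ltnW ?lt.
Qed.

Variables (c0 : nat) (a : bool).
Hypothesis stop1 : stops T1 x c0 a.

Lemma walk_col_before c : c < c0 ->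
  walk_col T2 x c = if z c then rcons (walk_col T1 x c) v else walk_col T1 x c.
Proof.
move=> ltc; have [w [w0 _ _]] := stop1.
case wc1: (walk T1 x c.+1) => [w'|]; last by rewrite (walk_None wc1) in w0.
move: wc1; rewrite /=; case wc: (walk T1 x c) => [w1|] //; case: ifP => // lt _.
have ltw := walk_lt wc.
rewrite /walk_col (walk_add_max wc) wc find_add_max // replaces_add_max // T2E.
by case: (z c); case: ifP => // _; rewrite set_nth_rcons.
Qed.

Lemma walk_col_after c : c0 < c -> walk_col T1 x c = T1 c.
Proof.
by have [w [w0 fE _]] := stop1 => lt; apply: walk_col_last w0 _ lt; rewrite fE.
Qed.

(** Only in the final column [c0] can [v] be bumped: earlier columns bump an older, smaller entry.
    Nothing exceeds [v], so the insertion then ends one column further on. *)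
Lemma walk_next : z c0 -> walk T2 x c0.+1 = Some (v, size (T1 c0), a).
Proof.
have [w [w0 fE rE]] := stop1 => zc; have ltw := walk_lt w0; rewrite /=.
rewrite (walk_add_max w0) find_add_max // replaces_add_max // fE rE.
by rewrite T2E zc size_rcons ltnSn nth_rcons ltnn eqxx.
Qed.

Lemma walk_next2 : z c0 -> walk T2 x c0.+2 = None.
Proof.
by move=> zc; rewrite (walkS (walk_next zc)) find_ltn_max ?ltnn ?add_max_le.
Qed.

Lemma replaces_next : replaces (T2 c0.+1) (v, size (T1 c0), a) =
  ~~ z c0.+1 && ((size (T1 c0.+1) < size (T1 c0)) || a).
Proof.
rewrite /replaces /= mem_add_max find_ltn_max ?add_max_le // T2E.
by case: (z c0.+1).
Qed.

Lemma stops_add_max :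
  stops T2 x (if z c0 then c0.+1 else c0)
    (if z c0 then ~~ z c0.+1 && ((size (T1 c0.+1) < size (T1 c0)) || a) else a).
Proof.
case: ifP => zc.
  exists (v, size (T1 c0), a); split; [exact: walk_next| |exact: replaces_next].
  by rewrite find_ltn_max // add_max_le.
have [w [w0 fE rE]] := stop1; exists w; split; first exact: walk_add_max.
  by rewrite T2E zc.
by rewrite T2E zc.
Qed.

(** Two columns are exceptional once [v] is bumped: [c0], where [v] gives way exactly when the
    earlier insertion changed that column, and [c0.+1], which receives [v] if its height or the flag
    permits. *)
Lemma walk_col_add_max (c : nat) (b := if z c0 then
    if c == c0 then ~~ a else
    if c == c0.+1 then z c || ((size (T1 c) < size (T1 c0)) || a) else z c
  else z c) :
  walk_col T2 x c = if b then rcons (walk_col T1 x c) v else walk_col T1 x c.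
Proof.
have [w [w0 fE rE]] := stop1; have ltw := walk_lt w0.
have after : ~~ z c0 -> c0 < c -> walk_col T2 x c = T2 c.
  move=> zc lt; apply: walk_col_last (walk_add_max w0) _ lt.
  by rewrite find_add_max // fE T2E (negPf zc).
rewrite /b; case: (ltngtP c c0) => [ltc|ltc|->].
- by rewrite (ltn_eqF (leqW ltc)) if_same walk_col_before.
- rewrite walk_col_after //; have [cE|nc] := eqVneq c c0.+1.
    have [zc|zc] := boolP (z c0); last by rewrite after // T2E.
    rewrite cE.
    rewrite /walk_col walk_next // replaces_next find_ltn_max ?add_max_le //=.
    rewrite T2E; case: (z c0.+1) => //=; case: ifP => // _.
    by rewrite set_nth_size.
  rewrite if_same; have [zc|zc] := boolP (z c0).
    by rewrite /walk_col (walk_None (walk_next2 zc)) ?T2E //; lia.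
  by rewrite after // T2E.
rewrite /walk_col (walk_add_max w0) w0 find_add_max // replaces_add_max // fE rE.
rewrite T2E; case: (z c0) => //; case: a => //=.
by elim: (T1 c0) => //= b' s ->.
Qed.

End AddMaximum.

(** * Hecke insertion as a scan of the values *)

(* An event [(r, a)] records that an insertion restricted to the values [<= v]
   ends in row [r] and adds a cell there iff [a]; the column is then
   [cnt f v r].  [carry f v r] is the event after [v.+1] enters this column, and
   [k] below is the row in which an insertion starts, which has no entry up to
   the inserted letter [x]. *)
Fixpoint carry f v r : nat * bool :=
  if r is r'.+1 then
    if cnt f v r' != cnt f v r then (r, true)
    else if f v.+1 r' then (r, false) else carry f v r'
  else (0, true).

(** Here [v.+1] sits where the restricted insertion ended and the next column is shorter. If instead
    the next column reaches down to the same row, or if that row is row 0, a bumped [v.+1] moves to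
    the right within its row and the state persists. *)
Definition hits f v (e : nat * bool) : bool :=
  [&& f v.+1 e.1, 0 < e.1 & cnt f v e.1.-1 == (cnt f v e.1).+1].

(** [carry] does not test its starting row, hence the separate case: an occurrence of [v.+1] in the
    row above lies in the next column and blocks the bumped one. *)
Definition bump_event f v (e : nat * bool) : nat * bool :=
  if hits f v e then
    if f v.+1 e.1.-1 then (e.1, false) else carry f v e.1.-1
  else e.

Fixpoint event f k x v : nat * bool :=
  if v is v'.+1 then
    if v' < x.-1 then (k, true)
    else if v' == x.-1 then carry f v' k else bump_event f v' (event f k x v')
  else (k, true).

Definition insert f k x : filling := fun v r =>
  if v < x then f v r else
  let e := event f k x v in
  if v == x then f v r || (e.2 && (r == e.1)) else
  let e0 := event f k x v.-1 in
  if hits f v.-1 e0 then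
    (f v r && ~~ (e0.2 && (r == e0.1))) || (e.2 && (r == e.1))
  else f v r.

Lemma eventS f k x v : x <= v -> 0 < x -> event f k x v.+1 = bump_event f v (event f k x v).
Proof. by case: x => // x lt _ /=; rewrite !ifF //; apply/negP; lia. Qed.

Lemma event_start f k x : event f k x.+1 x.+1 = carry f x k.
Proof. by rewrite /= ltnn eqxx. Qed.

Lemma insertS f k x v r (e0 := event f k x v) (e := event f k x v.+1) : x <= v ->
  insert f k x v.+1 r =
  if hits f v e0 then (f v.+1 r && ~~ (e0.2 && (r == e0.1))) || (e.2 && (r == e.1))
  else f v.+1 r.
Proof. by move=> le; rewrite /insert ltnNge leqW //= gtn_eqF // ltnS. Qed.

Lemma insert_start f k x r : insert f k x.+1 x.+1 r =
  f x.+1 r || ((carry f x k).2 && (r == (carry f x k).1)).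
Proof. by rewrite /insert ltnn eqxx event_start. Qed.

(** The rows as long as row [r] form a block with top row [q]. By [is_tab] only the top row of a
    block can hold [v.+1], so the upward search either meets it there or reaches [q] freely. The
    recursive form of [carry] is the one that the transducers follow. *)
Lemma carryE f v r (q := size (col f v (cnt f v r))) : is_tab f v.+1 -> ~~ f v.+1 r ->
  [/\ carry f v r = if f v.+1 q then (q.+1, false) else (q, true),
      cnt f v q = cnt f v r, q <= r & f v.+1 q -> q < r].
Proof.
move=> tf; have tf' := is_tabW (leqnSn v) tf.
rewrite {}/q; elim: r => [|r IH] nf.
  have -> : size (col f v (cnt f v 0)) = 0 by apply: size_colE.
  by rewrite (negPf nf) //; split=> //; rewrite (negPf nf).
rewrite [carry _ _ _]/=; have [cE|ncE] := eqVneq (cnt f v r) (cnt f v r.+1); last first.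
  have le := cnt_tab r tf'.
  have -> : size (col f v (cnt f v r.+1)) = r.+1 by apply: size_colE => //= _; lia.
  by rewrite (negPf nf); split=> //; rewrite (negPf nf).
rewrite -cE /=; have [fr|nfr] := boolP (f v.+1 r).
  by rewrite size_col_cnt // fr; split.
have [-> cE' le lt] := IH nfr; by split=> //; exact: leqW.
Qed.

Section HeckeIsInsert.

Variables (f : filling) (k x m : nat).
Hypothesis tf : is_tab f m.
Hypothesis fresh : cnt f x k = 0.
Hypothesis nfk : ~~ f x.+1 k.

Let g := insert f k x.+1.
Let e v := event f k x.+1 v.

Lemma cnt_insert_lt u r : u <= x -> cnt g u r = cnt f u r.
Proof.
move=> le; apply: eq_cnt => w s lew; rewrite /g /insert ifT //; lia.
Qed.

Lemma col_insert_lt u c : u <= x -> col g u c = col f u c.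
Proof.
move=> le; apply: eq_col => w s lew; rewrite /g /insert ifT //; lia.
Qed.

(** The invariant of the scan: the event describes the true end of the walk in the tableau
    restricted to values [<= v], and the restricted insertion has the columns predicted by
    [insert]. *)
Record insert_spec v : Prop := InsertSpec {
  spec_stops : stops (col f v) x.+1 (cnt f v (e v).1) (e v).2;
  spec_col : forall c, walk_col (col f v) x.+1 c = col g v c;
  spec_cnt : forall r, cnt g v r = cnt f v r + ((e v).2 && (r == (e v).1));
  spec_size : size (col f v (cnt f v (e v).1)) = (e v).1;
  spec_tab : is_tab g v }.

Lemma col_lt u c : all (fun w => w < u.+1) (col f u c).
Proof. exact: col_le. Qed.

Lemma is_tabS h v : is_tab h v ->
  (forall r, h v.+1 r.+1 -> cnt h v r.+1 < cnt h v r) -> is_tab h v.+1.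
Proof.
move=> th hv u r; rewrite ltnS leq_eqVlt => /orP[/eqP ->|]; [exact: hv|exact: th].
Qed.

Lemma insert_spec_start : x < m -> insert_spec x.+1.
Proof.
move=> ltx; have tf1 : is_tab f x.+1 by apply: is_tabW tf.
have tf0 : is_tab f x by apply: is_tabW tf1.
have [] := carryE tf1 nfk; rewrite fresh.
set q := size (col f x 0) => cE cq leqk ltqk.
have eE : e x.+1 = if f x.+1 q then (q.+1, false) else (q, true).
  by rewrite /e event_start.
(* Both outcomes of [carry] are covered at once: if row [q] already holds the letter, adding it
   there changes nothing. *)
have gE r : g x.+1 r = f x.+1 r || (r == q).
  rewrite /g insert_start cE; case: ifP => //= fq.
  by rewrite orbF; case: eqP => [->|]; rewrite ?fq ?orbF.
have gx r : cnt g x r = cnt f x r by rewrite cnt_insert_lt.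
have q0 : in_col f x 0 = f x.+1 q by rewrite /in_col -/q cq eqxx andbT.
have tg : is_tab g x.+1.
  apply: is_tabS => [u r ltu|r]; rewrite ?gx.
    have -> : g u.+1 r.+1 = f u.+1 r.+1 by rewrite /g /insert ltnS ltu.
    by rewrite !cnt_insert_lt ?(ltnW ltu) //; apply: tf0.
  rewrite gE => /orP[|/eqP rq]; first exact: tf1.
  by rewrite rq cq -ltn_size_col // -/q -rq.
have cq1 : cnt f x q.+1 = 0 by have := cnt_tab q tf0; lia.
have fq1 : ~~ f x.+1 q.+1.
  by apply/negP => /(tf1 x q (ltnSn x)); rewrite cq.
have cnte : cnt f x.+1 (e x.+1).1 = 0.
  rewrite eE /=; case: ifP => /= fq; first by rewrite cq1 (negPf fq1).
  by rewrite cq fq.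
split=> //.
- rewrite cnte eE; have := stops_max (col_lt x) (colS f x).
  by rewrite q0; case: (f x.+1 q).
- move=> c; rewrite (walk_max (col_lt x) (colS f x)).
  rewrite [RHS]colS col_insert_lt //.
  suff -> : in_col g x c = (c == 0) || in_col f x c by case: eqP => [->|].
  apply/(in_colP _ tg)/orP => [[r]|].
    rewrite gE gx => /orP[fr rc|/eqP -> <-]; last by rewrite cq; left.
    by right; apply/(in_colP _ tf1); exists r.
  case=> [/eqP ->|/(in_colP _ tf1)[r fr rc]].
    by exists q; rewrite ?gE ?eqxx ?orbT // gx.
  by exists r; rewrite ?gE ?fr ?gx.
- move=> r; rewrite /= gx gE eE -addnA; congr addn.
  by case: ifP => fq /=; case: eqP => [->|]; rewrite ?fq ?orbF ?addn0.
rewrite cnte colS q0 eE; by case: ifP => // fq; rewrite size_rcons.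
Qed.

Lemma insert_spec_step v : x < v < m -> insert_spec v -> insert_spec v.+1.
Proof.
case/andP=> ltxv ltvm [st colE cntE szE tg].
have tf1 : is_tab f v.+1 by apply: is_tabW tf.
have tf0 : is_tab f v by apply: is_tabW tf1.
have eS : e v.+1 = bump_event f v (e v) by rewrite /e eventS.
have gS r : g v.+1 r = if hits f v (e v) then
    (f v.+1 r && ~~ ((e v).2 && (r == (e v).1))) ||
    ((e v.+1).2 && (r == (e v.+1).1)) else f v.+1 r by rewrite /g insertS.
move: st cntE szE eS gS; case: (e v) => r0 a /=; set c0 := cnt f v r0.
move=> st cntE szE eS gS.
have stE := stops_add_max (col_lt v) (colS f v) (ltxv : x.+1 < v.+1) st.
have colE1 c := walk_col_add_max (col_lt v) (colS f v) (ltxv : x.+1 < v.+1) st c.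
have z0 : in_col f v c0 = f v.+1 r0 by rewrite /in_col szE eqxx andbT.
have colP (b : nat -> bool) :
    (forall c, walk_col (col f v.+1) x.+1 c = if b c
       then rcons (walk_col (col f v) x.+1 c) v.+1 else walk_col (col f v) x.+1 c) ->
    is_tab g v.+1 -> (forall c, b c <-> exists2 r, g v.+1 r & cnt g v r = c) ->
    forall c, walk_col (col f v.+1) x.+1 c = col g v.+1 c.
  move=> bE tg1 bP c; rewrite bE colE colS.
  suff -> : b c = in_col g v c by [].
  by apply/idP/(in_colP _ tg1) => /bP.
(* Without a hit, [v.+1] is either absent from row [r0] or moves at most one column to the right
   inside it; the rows containing it stay the same. *)
have [hit|nhit] := boolP (hits f v (r0, a)); last first.
  rewrite /bump_event (negPf nhit) in eS gS.
  have tg1 : is_tab g v.+1.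
    apply: is_tabS => // r; rewrite gS => fr; rewrite !cntE.
    have := tf1 v r (ltnSn v) fr; move: nhit; rewrite /hits /=.
    case: (eqVneq r.+1 r0) => [<-|]; last by rewrite andbF; case: (_ && _); lia.
    rewrite fr /= eqn_leq => nle; rewrite andbT.
    have -> : (r == r.+1) = false by lia.
    by case: (a); lia.
  have cnt1 r : cnt g v.+1 r = cnt f v.+1 r + (a && (r == r0)).
    by rewrite /= gS cntE addnAC.
  have [f0|nf0] := boolP (f v.+1 r0); last first.
    rewrite z0 (negPf nf0) in stE colE1.
    have c1 : cnt f v.+1 r0 = c0 by rewrite /= (negPf nf0) addn0.
    split; rewrite ?eS ?c1 //.
    - apply: colP colE1 tg1 _ => c; split.
        move/(in_colP _ tf1)=> [r fr rc]; exists r; rewrite ?gS // cntE rc.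
        by case: eqP fr nf0 => [-> ->//|]; rewrite andbF addn0.
      case=> r; rewrite gS cntE => fr rc; apply/(in_colP _ tf1); exists r => //.
      by move: rc; case: eqP fr nf0 => [-> ->//|]; rewrite andbF addn0.
    - by rewrite colS z0 (negPf nf0).
  have c1 : cnt f v.+1 r0 = c0.+1 by rewrite /= f0 addn1.
  have sz1 : size (col f v c0.+1) = r0.
    apply: size_colE => // r0_gt0; move: nhit; rewrite /hits /= f0 r0_gt0 /= -/c0.
    have := tf1 v r0.-1 (ltnSn v); rewrite prednK // => /(_ f0); rewrite -/c0; lia.
  have z1 : in_col f v c0.+1 = false by rewrite /in_col sz1 ltn_eqF ?andbF.
  rewrite z0 f0 z1 szE sz1 ltnn /= in stE colE1.
  split; rewrite ?eS ?c1 //.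
  - apply: colP colE1 tg1 _ => c; split.
      case: eqP => [->|nc0].
        by move=> na; exists r0; rewrite ?gS // cntE (negPf na) addn0.
      case: eqP => [->|nc1].
        rewrite z1 sz1 ltnn /= => ta; exists r0; rewrite ?gS //.
        by rewrite cntE ta eqxx addn1.
      move/(in_colP _ tf1)=> [r fr rc]; exists r; rewrite ?gS // cntE rc.
      by case: eqP rc => [->|]; rewrite ?andbF ?addn0 // => /esym.
    case=> r; rewrite gS cntE => fr; case: eqP => [->|nr].
      rewrite -/c0 => <-; case: (a) => /=; rewrite ?addn0 ?addn1 ?eqxx //.
      by rewrite gtn_eqF // z1 sz1 ltnn.
    rewrite andbF addn0 => rc; have zc : in_col f v c.
      by apply/(in_colP _ tf1); exists r.
    rewrite zc; case: eqP => [c_eq|_]; last by rewrite if_same.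
    by case: nr; rewrite -szE -c_eq -rc size_col_cnt.
  - by rewrite colS z1.
case/and3P: (hit) => /= f0 r0_gt0 /eqP c0S0.
have [r1 r0E] : exists r1, r0 = r1.+1 by exists r0.-1; rewrite prednK.
rewrite /bump_event hit {hit} /= in eS gS.
(* The height of the next column: the row in which the bumped value gets a new cell or meets a copy
   of itself. *)
set q := size (col f v c0.+1).
have c0S : cnt f v r1 = c0.+1 by move: c0S0; rewrite /c0 r0E.
rewrite r0E /= in eS.
have [eE cq ltq] : [/\ e v.+1 = if f v.+1 q then (q.+1, false) else (q, true),
    cnt f v q = c0.+1 & q < r0].
  rewrite eS r0E; have [f1|nf1] := boolP (f v.+1 r1).
    have -> : q = r1 by rewrite /q -c0S size_col_cnt.
    by rewrite f1; split.
  by have [] := carryE tf1 nf1; rewrite c0S -/q => -> -> le _; split.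
have nqr : (q == r0) = false by rewrite ltn_eqF.
have gE r : g v.+1 r = (f v.+1 r && ~~ (a && (r == r0))) || (r == q).
  rewrite gS eE; case: ifP => //= fq; rewrite orbF.
  by case: (eqVneq r q) => [->|]; rewrite ?orbF ?fq ?nqr ?andbF.
have tg1 : is_tab g v.+1.
  apply: is_tabS => // r; rewrite gE => /orP[/andP[fr nr]|/eqP rq].
    by have := tf1 v r (ltnSn v) fr; rewrite !cntE (negPf nr); lia.
  rewrite !cntE rq nqr andbF addn0 cq.
  have : r < q by rewrite -rq.
  by rewrite /q ltn_size_col //; lia.
have fq1 : f v.+1 q -> cnt f v.+1 q.+1 = c0.+1.
  move=> fq; have := tf1 v q (ltnSn v); have := cnt_tab q tf0; rewrite cq /=.
  have [->|nq] := eqVneq q r1; first by rewrite -r0E f0 -/c0 addn1.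
  have : cnt f v r1 <= cnt f v q.+1 by apply: cnt_tab_le => //; lia.
  by rewrite c0S; case: (f v.+1 q.+1) => [? ? /(_ isT)|? ? _]; lia.
have c1 : cnt f v.+1 (e v.+1).1 = c0.+1.
  rewrite eE; case: ifP => fq /=; first by rewrite -fq1.
  by rewrite cq fq addn0.
have z1 : in_col f v c0.+1 = f v.+1 q by rewrite /in_col -/q cq eqxx andbT.
rewrite z0 f0 z1 szE -/q ltq /= andbT in stE.
split; rewrite ?c1 //.
- by move: stE; rewrite eE; case: ifP.
- apply: colP colE1 tg1 _ => c; rewrite z0 f0; split.
    case: eqP => [->|nc0].
      move=> na; exists r0; rewrite ?gE ?f0 ?(negPf na) //.
      by rewrite cntE (negPf na) addn0.
    case: eqP => [->|nc1].
      by move=> _; exists q; rewrite ?gE ?eqxx ?orbT // cntE nqr andbF addn0.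
    move/(in_colP _ tf1)=> [r fr rc]; have nr : r == r0 = false.
      by apply/eqP => rr; case: nc0; rewrite -rc rr.
    by exists r; rewrite ?gE ?fr ?cntE ?nr ?andbF ?addn0.
  case=> r; rewrite gE cntE => /orP[/andP[fr nr]|/eqP ->]; last first.
    by rewrite nqr andbF addn0 cq => <-; rewrite gtn_eqF // eqxx szE -/q ltq orbT.
  rewrite (negPf nr) addn0 => rc; have zc : in_col f v c.
    by apply/(in_colP _ tf1); exists r.
  rewrite zc if_same; case: eqP => // cc; move: nr.
  have -> : r = r0 by rewrite -szE -cc -rc size_col_cnt.
  by rewrite eqxx andbT.
- move=> r; rewrite [cnt g _ _]/= [cnt f _ r]/= gE cntE eE -!addnA; congr addn.
  case: (eqVneq r r0) => [->|nr0].
    by rewrite f0 eq_sym nqr; case: ifP => fq; case: (a); rewrite //= eq_sym nqr.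
  rewrite andbF /=; case: ifP => fq /=; case: (eqVneq r q) => [->|nrq];
    by rewrite ?fq ?orbF ?andbT ?addn0.
rewrite colS z1 eE; by case: ifP => // fq; rewrite size_rcons.
Qed.

End HeckeIsInsert.

Lemma insert_specP f k x m : is_tab f m -> cnt f x k = 0 -> ~~ f x.+1 k -> x < m ->
  forall v, x < v <= m -> insert_spec f k x v.
Proof.
move=> tf fresh nfk ltxm; elim=> // v IH /andP[ltxv levm].
move: ltxv; rewrite ltnS leq_eqVlt => /orP[/eqP <-|ltxv].
  exact: insert_spec_start tf fresh nfk ltxm.
by apply: (insert_spec_step tf fresh nfk); rewrite ?ltxv //; apply: IH; rewrite ltxv ltnW.
Qed.

Lemma eq_walk T1 T2 x : T1 =1 T2 -> walk_col T1 x =1 walk_col T2 x.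
Proof.
move=> eqT c; rewrite /walk_col eqT.
by have -> : walk T1 x c = walk T2 x c by elim: c => //= c ->; rewrite eqT.
Qed.

Lemma hecke_insert_col T f k x m : increasing_tableau T ->
  nth [::] T =1 col f m -> is_tab f m ->
  cnt f x k = 0 -> ~~ f x.+1 k -> x < m ->
  [/\ increasing_tableau (hecke_insert T x.+1),
      nth [::] (hecke_insert T x.+1) =1 col (insert f k x.+1) m &
      is_tab (insert f k x.+1) m].
Proof.
move=> incT TE tf fresh nfk ltxm; have [incT' T'E] := hecke_insert_walk x.+1 incT.
have [|_ colE _ _ tg] := insert_specP tf fresh nfk ltxm (v := m); first by rewrite ltxm /=.
by split=> // c; rewrite T'E (eq_walk _ TE) colE.
Qed.

(** * The transducers of the crystal operators *)

(* One letter of the transducer computing [E_i] on rows [i] and [i+1]: [d] is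
   [phi_i] of the smaller letters, [a] and [b] tell whether the letter lies in
   row [i] and in row [i+1]. *)
Definition up_bit (d : nat) (a b : bool) : bool := a || b && (d < 2).
Definition down_bit (d : nat) (b : bool) : bool := b && (0 < d).
(** The formula [phi b + (phi c - eps b)] for a tensor product with [phi c = d]; the pair of [phi]
    and [eps] is (2,0) for [{i}], (1,1) for [{i,i+1}] and (0,2) for [{i+1}]. *)
Definition next_phi (d : nat) (a b : bool) : nat :=
  if b then if a then maxn d 1 else d - 2 else if a then d.+2 else d.

Lemma up_bit_big d a (b : bool) : (b -> 1 < d) -> up_bit d a b = a.
Proof. by rewrite /up_bit; case: b => [/(_ isT)|_]; case: a => //=; lia. Qed.

Lemma next_phi_loss d a (b c : bool) : (b -> 3 < d) -> 1 < d ->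
  next_phi (d - c.+1) a b = next_phi d a b - c.+1.
Proof.
by rewrite /next_phi; case: b => [/(_ isT)|_]; case: a; case: c => /=; lia.
Qed.

Lemma next_phi_gt1 d a (b : bool) : (b -> 3 < d) -> 1 < d -> 1 < next_phi d a b.
Proof. by rewrite /next_phi; case: b => [/(_ isT)|_]; case: a => /=; lia. Qed.

Lemma next_phi_double c c' (a b : bool) : 1 < (c - c').*2 ->
  next_phi (c - c').*2 a b = ((c + a) - (c' + b)).*2.
Proof. by rewrite /next_phi; case: b; case: a => /=; lia. Qed.

Section Layer.

Variables (al : nat -> bool) (D : nat -> nat).

(** One letter goes through the whole chain: [al] gives its rows and [D r] the counter of the
    operator on rows [r-1] and [r]. With bit [b] entering row [r], the value at [s <= r] is the bit
    of row [s] left by the operators below, just before the operator on rows [s-1] and [s] reads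
    it. *)
Fixpoint pass (r : nat) (b : bool) (s : nat) : bool :=
  if s == r then b else
  if r is r'.+1 then pass r' (up_bit (D r) (al r') b) s else b.

Definition pass_bit r b s : bool :=
  if s == 0 then pass r b s else down_bit (D s) (pass r b s).

Definition pass_phi r b s : nat := next_phi (D s) (al s.-1) (pass r b s).

Lemma pass_id r b : pass r b r = b.
Proof. by case: r => [|r] /=; rewrite ?eqxx. Qed.

Lemma passS r b s : s <= r -> pass r.+1 b s = pass r (up_bit (D r.+1) (al r) b) s.
Proof. by move=> le; rewrite /= ltn_eqF. Qed.

Lemma pass_cat k b r s : s <= r -> r <= k -> pass k b s = pass r (pass k b r) s.
Proof.
move=> lesr; elim: k b => [|k IH] b.
  by rewrite leqn0 => /eqP r0; move: lesr; rewrite r0 leqn0 => /eqP ->.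
rewrite leq_eqVlt => /orP[/eqP <-|]; first by rewrite pass_id.
by rewrite ltnS => le; rewrite !passS // ?(leq_trans lesr le) // IH.
Qed.

(** The tableau situation, with row lengths [c]. An upper letter adds 2 to the counter and a lower
    one takes 2 away, so the counter is twice the difference of lengths; on such input the operators
    change nothing. *)
Definition gap (c : nat -> nat) s : Prop :=
  forall r, r < s -> D r.+1 = (c r - c r.+1).*2 /\ c r.+1 + al r.+1 <= c r.

Lemma gapW c s r : r <= s -> gap c s -> gap c r.
Proof. by move=> le g q ltq; apply: g; apply: leq_trans le. Qed.

Lemma pass_gap c s r : gap c s -> r <= s -> pass s (al s) r = al r.
Proof.
elim: s => [|s IH] g; first by rewrite leqn0 => /eqP ->; rewrite pass_id.
rewrite leq_eqVlt => /orP[/eqP ->|]; first by rewrite pass_id.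
rewrite ltnS => ler; rewrite passS //.
have -> : up_bit (D s.+1) (al s) (al s.+1) = al s.
  have [-> le] := g s (ltnSn s); rewrite /up_bit.
  by case: (al s.+1) le => le /=; rewrite ?orbF //; case: (al s) => //=; lia.
by apply: IH => //; apply: gapW g.
Qed.

Lemma pass_bit_gap c s r : gap c s -> r <= s -> pass_bit s (al s) r = al r.
Proof.
move=> g le; rewrite /pass_bit (pass_gap g le); case: r le => //= r ltr.
have [-> le] := g r ltr; rewrite /down_bit; case: (al r.+1) le => //=; lia.
Qed.

Lemma pass_phi_gap c s r : gap c s -> r < s ->
  pass_phi s (al s) r.+1 = ((c r + al r) - (c r.+1 + al r.+1)).*2.
Proof.
move=> g ltr; rewrite /pass_phi (pass_gap g) //=; have [-> ] := g r ltr.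
rewrite /next_phi; case: (al r); case: (al r.+1) => /=; lia.
Qed.

End Layer.

Lemma eq_pass al1 al2 D1 D2 k b s : (forall r, r < k -> al1 r = al2 r) ->
  (forall r, s < r <= k -> D1 r = D2 r) ->
  s <= k -> pass al1 D1 k b s = pass al2 D2 k b s.
Proof.
elim: k b => [|k IH] b eqal eqD; first by rewrite leqn0 => /eqP ->.
rewrite leq_eqVlt => /orP[/eqP ->|]; first by rewrite !pass_id.
rewrite ltnS => le; rewrite !passS // eqal // eqD ?ltnS ?le ?leqnn //.
apply: IH => // r; first by move=> lt; apply: eqal; apply: ltnW.
by case/andP=> ltr ler; apply: eqD; rewrite ltr leqW.
Qed.

Definition loss (e : nat * bool) (r : nat) : nat := (r == e.1) * (e.2).+1.

Lemma loss_gt e r : e.1 < r -> loss e r = 0.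
Proof. by move=> lt; rewrite /loss gtn_eqF. Qed.

Lemma loss_lt e r : r < e.1 -> loss e r = 0.
Proof. by move=> lt; rewrite /loss ltn_eqF. Qed.

(** An extra bit in row [s] climbs as long as the counters vanish. A nonzero counter is at least 2
    and holds the bit, at a loss of 2. A zero counter sends it up: if the row above has the letter
    already, the bit is absorbed and the counter becomes 1 instead of 2; otherwise the bit goes on
    with no loss. This is the recursion of [carry]. *)
Lemma carry_layer (h : filling) v (al := h v.+1) D s (e := carry h v s) :
  gap al D (cnt h v) s -> ~~ al s ->
  [/\ e.1 <= s, e.1 = 0 -> e.2,
      forall r, r <= s -> pass_bit al D s true r = al r || (e.2 && (r == e.1)),
      forall r, r < s -> pass_phi al D s true r.+1 =
                         pass_phi al D s (al s) r.+1 - loss e r.+1 &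
      0 < e.1 -> 1 < pass_phi al D s (al s) e.1].
Proof.
rewrite {}/e; elim: s => [|s IH] g nal.
  by split=> //= r; rewrite leqn0 => /eqP ->; rewrite /pass_bit orbT.
have gs := gapW (leqnSn s) g; have [DE le] := g s (ltnSn s).
rewrite [carry _ _ _]/=; have [cE|ncE] := eqVneq (cnt h v s) (cnt h v s.+1); last first.
  have D2 : 1 < D s.+1 by rewrite DE; lia.
  have passE r : r <= s -> pass al D s.+1 true r = pass al D s.+1 (al s.+1) r.
    move=> ler; rewrite !passS //; congr pass; rewrite /up_bit (negPf nal).
    by rewrite ltnNge D2.
  split=> //=.
  - move=> r; rewrite leq_eqVlt => /orP[/eqP ->|ltr].
      by rewrite /pass_bit pass_id eqxx orbT /= /down_bit (ltnW D2).
    rewrite (ltn_eqF ltr) orbF -(pass_bit_gap g (ltnW ltr)) /pass_bit passE //.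
  - move=> r ltr; rewrite /loss /=; have [->|nr] := eqVneq r s.
      rewrite eqxx mul1n /pass_phi !pass_id (negPf nal) /next_phi /=.
      by case: (al s); lia.
    rewrite eqSS (negPf nr) subn0 /pass_phi passE //; lia.
  move=> _; rewrite /pass_phi pass_id (negPf nal) /next_phi /=.
  by case: (al s); lia.
have D0 : D s.+1 = 0 by rewrite DE cE subnn.
have passE r : r <= s -> pass al D s.+1 true r = pass al D s true r.
  by move=> ler; rewrite passS // D0 /up_bit orbT.
have passF r : r <= s -> pass al D s.+1 (al s.+1) r = pass al D s (al s) r.
  by move=> ler; rewrite passS // (negPf nal) /up_bit orbF.
have top : pass_bit al D s.+1 true s.+1 = false.
  by rewrite /pass_bit pass_id D0.
have bitE r : r <= s -> pass_bit al D s.+1 true r = pass_bit al D s true r.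
  by move=> ler; rewrite /pass_bit passE.
rewrite /= -/(al s); have [als|nals] := boolP (al s).
  split=> //=.
  - move=> r; rewrite leq_eqVlt => /orP[/eqP ->|ltr]; first by rewrite top orbF (negPf nal).
    by rewrite orbF bitE // -als (pass_bit_gap gs).
  - move=> r; rewrite ltnS => ler; rewrite /loss /=; have [->|nr] := eqVneq r s.
      by rewrite eqxx /pass_phi !pass_id (negPf nal) D0 /next_phi /= als.
    rewrite eqSS (negPf nr) subn0 /pass_phi passE ?passF ?als //; lia.
  by move=> _; rewrite /pass_phi pass_id (negPf nal) /next_phi /= als.
have [le1 z1 bits phis big] := IH gs nals; split=> //.
- exact: leqW.
- move=> r; rewrite leq_eqVlt => /orP[/eqP ->|ltr]; last by rewrite bitE // bits.
  by rewrite top (negPf nal) gtn_eqF ?ltnS // andbF.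
- move=> r; rewrite ltnS leq_eqVlt => /orP[/eqP ->|ltr].
    rewrite /loss gtn_eqF ?ltnS // subn0 /pass_phi !pass_id (negPf nal) D0.
    by rewrite /next_phi /= (negPf nals).
  by rewrite /pass_phi passE // passF //; apply: phis.
by move=> gt0; have := big gt0; rewrite /pass_phi passF.
Qed.

(** * Adding a letter to the last row *)

(* The chain [E_1 ... E_k] applied to [h]: [chain_phi h k v r] is the counter of
   the transducer on rows [r-1] and [r] after the letters up to [v]. *)
Fixpoint chain_phi (h : filling) k v r : nat :=
  if v is v'.+1 then pass_phi (h v) (chain_phi h k v') k (h v k) r else 0.

Definition chain (h : filling) k : filling := fun v r =>
  if v is v'.+1 then (r <= k) && pass_bit (h v) (chain_phi h k v') k (h v k) r
  else false.

Lemma chain_phiS h k v r : chain_phi h k v.+1 r =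
  pass_phi (h v.+1) (chain_phi h k v) k (h v.+1 k) r.
Proof. by []. Qed.

Lemma chainS h k v r : chain h k v.+1 r =
  (r <= k) && pass_bit (h v.+1) (chain_phi h k v) k (h v.+1 k) r.
Proof. by []. Qed.

Arguments cnt : simpl never.
Arguments chain : simpl never.
Arguments chain_phi : simpl never.

Definition tab_rows (h : filling) k m : Prop :=
  forall u r, u < m -> r.+1 < k -> h u.+1 r.+1 -> cnt h u r.+1 < cnt h u r.

Lemma cnt_tab_rows h k m u r : tab_rows h k m -> u <= m -> r.+1 < k ->
  cnt h u r.+1 <= cnt h u r.
Proof.
move=> th; elim: u => // u IH ltu ltr; rewrite !cntS; have := IH (ltnW ltu) ltr.
by have := th u r ltu ltr; case: (h u.+1 r.+1) => [/(_ isT)|_]; lia.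
Qed.

Definition settled (h : filling) k s v : Prop :=
  (forall r, r < s -> chain_phi h k v r.+1 = (cnt h v r - cnt h v r.+1).*2) /\
  (forall r, r <= s -> cnt (chain h k) v r = cnt h v r).

Lemma settledW h k s r v : r <= s -> settled h k s v -> settled h k r v.
Proof.
by move=> le [phiE cE]; split=> q ltq; [apply: phiE|apply: cE]; apply: leq_trans le.
Qed.

Lemma settled_gap h k s v : settled h k s v ->
  (forall r, r < s -> cnt h v r.+1 + h v.+1 r.+1 <= cnt h v r) ->
  gap (h v.+1) (chain_phi h k v) (cnt h v) s.
Proof. by move=> [phiE _] le r ltr; rewrite phiE //; split=> //; apply: le. Qed.

(** If the bit arriving in row [s] is the one already there, nothing crosses from below, and the
    rows above read one more letter of a tableau. *)
Lemma settledS h k s v : s <= k ->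
  (forall r, r < s -> cnt h v r.+1 + h v.+1 r.+1 <= cnt h v r) ->
  pass (h v.+1) (chain_phi h k v) k (h v.+1 k) s = h v.+1 s ->
  settled h k s v ->
  settled h k s v.+1 /\ (forall r, r <= s -> chain h k v.+1 r = h v.+1 r).
Proof.
move=> lesk le bs st; have g := settled_gap st le.
have passE r : r <= s -> pass (h v.+1) (chain_phi h k v) k (h v.+1 k) r =
    pass (h v.+1) (chain_phi h k v) s (h v.+1 s) r.
  by move=> ler; rewrite (pass_cat _ _ _ ler lesk) bs.
have bitE r : r <= s -> chain h k v.+1 r = h v.+1 r.
  move=> ler; rewrite -(pass_bit_gap g ler) /chain /pass_bit passE //.
  by rewrite (leq_trans ler lesk).
split=> //; split=> r ltr.
  by rewrite chain_phiS /pass_phi passE // -[LHS]/(pass_phi _ _ s _ _) (pass_phi_gap g).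
by have [_ cE] := st; rewrite !cntS cE // bitE.
Qed.

(** While row [k] is empty nothing is pushed up, and the chain is the identity on the tableau above
    it. *)
Lemma settled_empty h k m w : tab_rows h k m -> w <= m ->
  (forall u, u <= w -> ~~ h u k) ->
  forall v, v <= w -> settled h k k v /\ (forall r, 0 < v -> r <= k -> chain h k v r = h v r).
Proof.
move=> th lewm hk; have cntk v : v <= w -> cnt h v k = 0.
  by elim: v => // v IH lt; rewrite cntS IH ?(ltnW lt) // (negPf (hk _ lt)).
elim=> [|v IH] lt; first by split=> //; split.
have [|st bits] := IH _; first exact: ltnW.
have [||] := settledS (leqnn k) _ _ st.
- move=> r ltr; have [kE|nk] := eqVneq r.+1 k.
    by rewrite kE cntk ?(ltnW lt) // (negPf (hk _ lt)).
  have ltr' : r.+1 < k by rewrite ltn_neqAle nk.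
  have := cnt_tab_rows th (ltnW (leq_trans lt lewm)) ltr'.
  by have := th v r (leq_trans lt lewm) ltr'; case: (h v.+1 r.+1) => [/(_ isT)|_]; lia.
- by rewrite pass_id.
by move=> st' bits'; split=> // r _; apply: bits'.
Qed.

Lemma eq_chain_phi h1 h2 k v :
  (forall u r, 0 < u <= v -> r <= k -> h1 u r = h2 u r) ->
  forall r, r <= k -> chain_phi h1 k v r = chain_phi h2 k v r.
Proof.
elim: v => // v IH eqh r ler; have eqv q : q <= k -> h1 v.+1 q = h2 v.+1 q.
  by apply: eqh; rewrite leqnn.
have eqphi : forall q, q <= k -> chain_phi h1 k v q = chain_phi h2 k v q.
  by apply: IH => u q /andP[u0 leu]; apply: eqh; rewrite u0 leqW.
rewrite !chain_phiS /pass_phi eqphi // !eqv ?(leq_trans (leq_pred r)) //.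
by congr next_phi; apply: eq_pass => // q => [/ltnW|/andP[_]]; [apply: eqv|apply: eqphi].
Qed.

Lemma eq_chain h1 h2 k v r :
  (forall u q, 0 < u <= v -> q <= k -> h1 u q = h2 u q) ->
  chain h1 k v r = chain h2 k v r.
Proof.
case: v => // v eqh; rewrite !chainS; case: leqP => //= ler.
have eqv q : q <= k -> h1 v.+1 q = h2 v.+1 q by apply: eqh; rewrite leqnn.
have eqphi : forall q, q <= k -> chain_phi h1 k v q = chain_phi h2 k v q.
  by apply: eq_chain_phi => u q /andP[u0 leu]; apply: eqh; rewrite u0 leqW.
rewrite /pass_bit eqphi // !eqv //; congr (if _ then _ else down_bit _ _);
  by apply: eq_pass => // q => [/ltnW|/andP[_]]; [apply: eqv|apply: eqphi].
Qed.

Section Perturbation.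

Variables (h : filling) (k x m : nat).
Hypothesis th : tab_rows h k m.
Hypothesis ltxm : x < m.
Hypothesis hk : forall u, u <= x.+1 -> ~~ h u k.

Let h' : filling := fun v r => h v r || ((v == x.+1) && (r == k)).
Let f := chain h k.
Let f' := chain h' k.
Let D := chain_phi h k.
Let D' := chain_phi h' k.
Let e := event f k x.+1.

Lemma h'_lt u : u <= x -> h' u =1 h u.
Proof. by move=> le r; rewrite /h' ltn_eqF ?ltnS ?orbF. Qed.

Lemma h'_gt v : x < v -> h' v.+1 =1 h v.+1.
Proof. by move=> lt r; rewrite /h' gtn_eqF ?ltnS ?orbF. Qed.

(** [pert_big] and [pert_settled] carry the induction. At the row of the event the unperturbed
    counter is twice a difference of output lengths, hence even, although the rows below need not
    form a tableau; the length of the row above is taken in [h], which agrees with the output there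
    because that row is settled. *)
Record perturbed v : Prop := Perturbed {
  pert_row : (e v).1 <= k;
  pert_top : (e v).1 = 0 -> (e v).2;
  pert_phi : forall r, r < k -> D' v r.+1 = D v r.+1 - loss (e v) r.+1;
  pert_big : 0 < (e v).1 -> 1 < D v (e v).1 /\
    D v (e v).1 = (cnt h v (e v).1.-1 - cnt f v (e v).1).*2;
  pert_settled : 0 < (e v).1 -> settled h k (e v).1.-1 v;
  pert_chain : forall r, f' v r = insert f k x.+1 v r }.

Lemma eq_carry f1 f2 v s : (forall r, r <= s -> cnt f1 v r = cnt f2 v r) ->
  (forall r, r < s -> f1 v.+1 r = f2 v.+1 r) -> carry f1 v s = carry f2 v s.
Proof.
elim: s => //= s IH eqc eqf; rewrite !eqc // eqf // IH // => r lt.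
  by apply: eqc; apply: leqW.
by apply: eqf; apply: ltnW.
Qed.

Lemma settled_le s v : settled h k s v -> v < m -> s < k ->
  forall r, r < s -> cnt h v r.+1 + h v.+1 r.+1 <= cnt h v r.
Proof.
move=> st ltvm ltsk r ltr; have ltrk : r.+1 < k by apply: leq_ltn_trans ltsk.
have := cnt_tab_rows th (ltnW ltvm) ltrk.
by have := th ltvm ltrk; case: (h v.+1 r.+1) => [/(_ isT)|_]; lia.
Qed.

(** Row [k] is still empty, so all rows are settled and the new letter is the extra bit of
    [carry_layer]. *)
Lemma perturbed_start : perturbed x.+1.
Proof.
have [st0 _] := settled_empty th ltxm hk (leqnSn x).
have [st1 bits1] := settled_empty th ltxm hk (leqnn x.+1).
have nk : ~~ h x.+1 k by apply: hk.
have g : gap (h x.+1) (chain_phi h k x) (cnt h x) k.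
  apply: (settled_gap st0) => r ltr; have [kE|nrk] := eqVneq r.+1 k.
    rewrite -cntS kE.
    suff -> : cnt h x.+1 k = 0 by [].
    have cntk v : v <= x.+1 -> cnt h v k = 0.
      by elim: v => // v IH lt; rewrite cntS IH ?(ltnW lt) // (negPf (hk lt)).
    exact: cntk.
  have ltr' : r.+1 < k by rewrite ltn_neqAle nrk.
  have := cnt_tab_rows th (ltnW ltxm) ltr'.
  by have := th ltxm ltr'; case: (h x.+1 r.+1) => [/(_ isT)|_]; lia.
have eE : e x.+1 = carry h x k.
  rewrite /e event_start; apply: eq_carry => r ltr; first by have [_] := st0; apply.
  by apply: bits1 => //; apply: ltnW.
have [le top bits phis big] := carry_layer g nk.
have h'E : h' x.+1 =1 fun r => h x.+1 r || (r == k) by move=> r; rewrite /h' eqxx.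
have D'E r : r <= k -> D' x r = D x r.
  by apply: eq_chain_phi => u q /andP[_ leu] _; apply: h'_lt.
have passE r : r <= k -> pass (h' x.+1) (D' x) k (h' x.+1 k) r =
    pass (h x.+1) (D x) k true r.
  move=> ler; rewrite h'E eqxx orbT; apply: eq_pass => // q; last by case/andP=> _ /D'E.
  by move=> ltq; rewrite h'E ltn_eqF ?orbF.
have D'S r : D' x.+1 r = pass_phi (h' x.+1) (D' x) k (h' x.+1 k) r by [].
have f'S r : f' x.+1 r = (r <= k) && pass_bit (h' x.+1) (D' x) k (h' x.+1 k) r by [].
split; rewrite ?eE //.
- move=> r ltr; apply: etrans (phis r ltr); rewrite D'S /pass_phi passE // D'E //.
  by rewrite h'E ltn_eqF ?orbF.
- move=> gt0; split; first exact: big.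
  have [phi1 c1] := st1; have := phi1 (carry h x k).1.-1.
  by rewrite prednK // => /(_ le); rewrite /D /f c1.
- by move=> _; apply: settledW st1; apply: leq_trans (leq_pred _) le.
move=> r; rewrite insert_start -event_start -/(e x.+1) eE f'S.
have [ltkr|ler] := ltnP k r.
  by rewrite /f chainS leqNgt ltkr /= gtn_eqF ?andbF //; apply: leq_ltn_trans ltkr.
by rewrite andTb /f bits1 // -bits // /pass_bit passE // D'E.
Qed.

(* The event stays in its row as long as the counter of that row exceeds 2;
   otherwise a value entering the row pushes it upwards. *)
Lemma perturbed_step v : x < v < m -> perturbed v -> perturbed v.+1.
Proof.
case/andP=> ltxv ltvm [lek top phiE bigE st _].
have eS : e v.+1 = bump_event f v (e v) by rewrite /e eventS.
have insS r : insert f k x.+1 v.+1 r = if hits f v (e v) then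
    (f v.+1 r && ~~ ((e v).2 && (r == (e v).1))) ||
    ((e v.+1).2 && (r == (e v.+1).1)) else f v.+1 r by rewrite insertS.
move: lek top phiE bigE st eS insS; case: (e v) => r0 a /=.
move=> lek top phiE bigE st eS insS.
have h'E := h'_gt ltxv.
set al := h v.+1 in h'E; set b := pass al (D v) k (al k).
set b' := pass al (D' v) k (al k).
have D'S r : r < k -> D' v.+1 r.+1 = next_phi (D' v r.+1) (al r) (b' r.+1).
  move=> ltr; rewrite /D' chain_phiS /pass_phi h'E; congr next_phi.
  by rewrite h'E; apply: eq_pass.
have f'S r : f' v.+1 r =
    (r <= k) && if r == 0 then b' r else down_bit (D' v r) (b' r).
  rewrite /f' chainS; case: leqP => // ler; rewrite /pass_bit h'E /=.
  by congr (if _ then _ else down_bit _ _); apply: eq_pass.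
have DS r : D v.+1 r.+1 = next_phi (D v r.+1) (al r) (b r.+1) by [].
have fS r : f v.+1 r = (r <= k) && if r == 0 then b r else down_bit (D v r) (b r).
  by [].
have bE r : r0 <= r -> r <= k -> b' r = b r.
  move=> le0 ler; apply: eq_pass => // -[|q] /andP[ltr leq] //.
  by rewrite phiE // loss_gt ?subn0 //=; apply: leq_ltn_trans ltr.
have phiS r : r0 <= r -> r < k -> D' v.+1 r.+1 = D v.+1 r.+1.
  move=> le0 ltr; by rewrite D'S // DS bE ?leqW // phiE // loss_gt ?subn0.
have f'gt r : r0 < r -> f' v.+1 r = f v.+1 r.
  move=> lt0; rewrite f'S fS; case: leqP => //= ler; rewrite bE ?(ltnW lt0) //.
  case: r lt0 ler => // r lt0 ler; by rewrite phiE // loss_gt ?subn0.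
have [r0E|r0_gt0] := posnP r0.
  have nhit : hits f v (r0, a) = false by rewrite /hits r0E /= andbF.
  rewrite /bump_event nhit in eS insS.
  split; rewrite ?eS //= ?r0E //.
  - by move=> r ltr; rewrite phiS ?r0E // loss_gt ?subn0.
  - move=> r; rewrite insS; case: r => [|r]; last by rewrite f'gt ?r0E.
    by rewrite f'S fS bE ?r0E.
have [r1 r0E] : exists r1, r0 = r1.+1 by exists r0.-1; rewrite prednK.
subst r0; rewrite /= in lek top phiE bigE st eS insS bE phiS f'gt.
have {bigE} [d2 dE] := bigE isT; have {}st := st isT.
have le1 := settled_le st ltvm lek.
have g : gap al (D v) (cnt h v) r1 by apply: settled_gap st le1.
have c1 : cnt f v r1 = cnt h v r1 by have [_] := st; apply.
have bSr1 : b r1 = up_bit (D v r1.+1) (al r1) (b r1.+1).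
  rewrite /b (pass_cat _ _ _ (leqnSn r1) lek) passS // pass_id //.
have b'Sr1 : b' r1 = up_bit (D' v r1.+1) (al r1) (b r1.+1).
  by rewrite -bE // /b' (pass_cat _ _ _ (leqnSn r1) lek) passS // pass_id.
(* The unperturbed counter is at least 2, so that run hands no letter up past this row. *)
have b1 : b r1 = al r1 by rewrite bSr1 /up_bit (ltnNge _ 2) d2 andbF orbF.
have [stS bits] := settledS (ltnW lek) le1 b1 st.
have fr0 : f v.+1 r1.+1 = b r1.+1 by rewrite fS lek /= /down_bit ltnW ?andbT.
have bitsf r : r <= r1 -> f v.+1 r = al r by move=> ler; apply: bits.
(* Counter 2 says that the row above is longer by exactly one cell, which is the condition in
   [hits]. *)
have hitE : hits f v (r1.+1, a) = b r1.+1 && (D v r1.+1 == 2).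
  rewrite /hits /= fr0 c1 dE; congr andb; move: d2; rewrite dE.
  by clear; lia.
have D'1 : D' v r1.+1 = D v r1.+1 - a.+1 by rewrite phiE // /loss /= eqxx mul1n.
have low r : b' r1 = al r1 -> r <= r1 -> b' r = b r.
  move=> b'1 ler; rewrite /b /b' (pass_cat _ _ _ ler (ltnW lek)) -/(b' r1) b'1.
  rewrite [RHS](pass_cat _ _ _ ler (ltnW lek)) -/(b r1) b1.
  apply: eq_pass => // -[|q] /andP[ltr leq] //; rewrite phiE ?(leq_trans leq (ltnW lek)) //.
  by rewrite loss_lt ?subn0 //= ltnS.
have lowphi r : b' r1 = al r1 -> r < r1 -> D' v.+1 r.+1 = D v.+1 r.+1.
  move=> b'1 ltr; have ltrk := ltn_trans ltr lek; rewrite D'S // DS low // phiE //.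
  by rewrite loss_lt ?subn0.
have lowf r : b' r1 = al r1 -> r <= r1 -> f' v.+1 r = f v.+1 r.
  move=> b'1 ler; rewrite f'S fS low //; case: leqP => //= lerk.
  by case: r ler lerk => // r ler lerk; rewrite phiE // loss_lt ?subn0.
have [hit|nhit] := boolP (hits f v (r1.+1, a)); last first.
  rewrite /bump_event (negPf nhit) in eS insS; rewrite hitE in nhit.
  (* The counter is even, at least 2 and not 2, hence at least 4; after a loss of 1 or 2 it still
     reaches the threshold 2. *)
  have d4 : b r1.+1 -> 3 < D v r1.+1.
    by move=> br; move: nhit d2; rewrite br /= dE; case: (_ - _) => [|[]].
  have b'1 : b' r1 = al r1.
    rewrite b'Sr1 up_bit_big // D'1 => /d4; case: (a) {hitE phiE} => lt.
      by rewrite ltn_subRL.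
    by rewrite ltn_subRL ltnW.
  have DS1 := DS r1; have D'S1 := D'S r1 lek; rewrite bE // D'1 in D'S1.
  split; rewrite ?eS //=.
  - move=> r ltr; have [rE|nr] := eqVneq r r1.
      by rewrite rE D'S1 DS1 /loss /= eqxx mul1n next_phi_loss.
    rewrite /loss eqSS (negPf nr) subn0; case: (ltngtP r r1) nr => // lt _.
      exact: lowphi.
    by apply: phiS.
  - move=> _; rewrite !cntS fr0 DS1 -/al; split; first exact: next_phi_gt1.
    by rewrite {1}dE next_phi_double -?dE.
  move=> r; rewrite insS; case: (ltngtP r r1.+1) => [ltr|gtr|->].
  - exact: lowf.
  - exact: f'gt.
  rewrite f'S fS lek /= bE // D'1 /down_bit.
  have [br|//] := boolP (b r1.+1); rewrite (ltnW d2) subn_gt0.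
  by apply: leq_ltn_trans (d4 br); case: (a).
move: (hit); rewrite hitE => /andP[br /eqP dv2].
rewrite /bump_event hit /= in eS insS; rewrite dv2 in D'1.
have DS1 := DS r1; have D'S1 := D'S r1 lek; rewrite bE // D'1 br ?dv2 in D'S1 DS1.
have f'r1 : f' v.+1 r1.+1 = ~~ a by rewrite f'S lek bE //= br D'1; case: (a).
(* The lowered counter is 0 or 1, so the letter is sent up to row [r1]. If it is already there, the
   next counters are 2 and 1 and the loss becomes 1; otherwise both are 0 and the extra bit travels
   on as in [carry_layer]. *)
have [al1|nal1] := boolP (al r1).
  rewrite bitsf // al1 in eS.
  have b'1 : b' r1 = al r1 by rewrite b'Sr1 /up_bit al1.
  split; rewrite ?eS //=.
  - move=> r ltr; have [rE|nr] := eqVneq r r1.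
      by rewrite rE D'S1 DS1 /loss /= eqxx mul1n /next_phi al1; case: (a).
    rewrite /loss eqSS (negPf nr) subn0; case: (ltngtP r r1) nr => // lt _.
      exact: lowphi.
    by apply: phiS.
  - move=> _; rewrite !cntS fr0 br -/al al1 DS1 /next_phi al1; split=> //.
    by move: dE; rewrite dv2; clear; lia.
  move=> r; rewrite insS eS /= orbF; case: (ltngtP r r1.+1) => [ltr|gtr|->].
  - by rewrite andbF andbT; exact: lowf.
  - by rewrite andbF andbT; exact: f'gt.
  by rewrite fr0 br andbT.
rewrite bitsf // (negPf nal1) in eS.
have eE : e v.+1 = carry h v r1.
  rewrite eS; apply: eq_carry => r ltr; first by have [_] := st; apply.
  by rewrite bitsf // ltnW.
have [cle ctop cbits cphis cbig] := carry_layer g nal1.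
have b'1 : b' r1 = true by rewrite b'Sr1 br D'1 /up_bit orbC; case: (a).
have b'low r : r <= r1 -> b' r = pass al (D v) r1 true r.
  move=> ler; rewrite /b' (pass_cat _ _ _ ler (ltnW lek)) -/(b' r1) b'1.
  apply: eq_pass => // -[|q] /andP[ltr leq] //; rewrite phiE ?(leq_trans leq (ltnW lek)) //.
  by rewrite loss_lt ?subn0 //= ltnS.
have blow r : r <= r1 -> b r = pass al (D v) r1 (al r1) r.
  by move=> ler; rewrite /b (pass_cat _ _ _ ler (ltnW lek)) -/(b r1) b1.
have phiV r : r < r1 -> D' v r.+1 = D v r.+1.
  by move=> ltr; rewrite phiE ?(ltn_trans ltr lek) // loss_lt ?subn0.
split; rewrite ?eE //.
- by rewrite (leq_trans cle) // ltnW.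
- move=> r ltr; case: (ltngtP r r1) => [ltr1|gtr1|->].
  + by rewrite D'S // DS b'low // blow // phiV //; apply: cphis.
  + by rewrite phiS // loss_gt ?subn0 // ltnS (leq_trans cle) // ltnW.
  rewrite loss_gt ?ltnS // subn0 D'S1 DS1 (negPf nal1) /next_phi.
  by case: (a).
- move=> gt0; have := cbig gt0; have := cle; have [phi1 cnt1] := stS.
  case: (carry h v r1).1 gt0 => // q _ leq; rewrite -/(D v.+1 q.+1).
  rewrite /pass_phi -blow // -DS /= cnt1 //; split=> //; exact: phi1.
- by move=> _; apply: settledW stS; apply: leq_trans (leq_pred _) cle.
move=> r; rewrite insS eE; case: (ltngtP r r1.+1) => [ltr|gtr|->].
- rewrite andbF andbT bitsf // -cbits // f'S /pass_bit.
  rewrite (leq_trans (ltr : r <= r1) (ltnW lek)) b'low //.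
  by case: r ltr => // r ltr; rewrite phiV.
- by rewrite andbF andbT f'gt // [_ == _]gtn_eqF ?andbF ?orbF // (leq_ltn_trans cle) // ltnW.
rewrite fr0 br andbT /= gtn_eqF ?ltnS // andbF orbF; exact: f'r1.
Qed.

End Perturbation.

Definition add_letter (h : filling) k x : filling :=
  fun v r => h v r || ((v == x) && (r == k)).

Lemma chain_add_letter h k x m : tab_rows h k m -> x < m ->
  (forall u, u <= x.+1 -> ~~ h u k) ->
  forall v r, 0 < v <= m ->
  chain (add_letter h k x.+1) k v r = insert (chain h k) k x.+1 v r.
Proof.
move=> th ltxm hk v r /andP[v_gt0 levm]; have [ltxv|levx] := ltnP x v; last first.
  rewrite /insert ifT // -(eq_chain (h1 := h)) // => u q /andP[_ leu] _.
  by rewrite /add_letter ltn_eqF ?orbF // ltnS (leq_trans leu).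
suff [_ _ _ _ _ ->] : perturbed h k x v by [].
elim: v ltxv levm {v_gt0} => // v IH; rewrite ltnS leq_eqVlt => /orP[/eqP <-|ltxv] levm.
  exact: perturbed_start th ltxm hk.
by apply: (perturbed_step th) => //; [rewrite ltxv|apply: IH; rewrite // ltnW].
Qed.

(** * Tensor products of seminormal crystals *)

Section Strings.

Variables (B : finType) (g : B -> option B).

Definition finite_strings : Prop := forall b, exists k, iter_op g k b = None.

Lemma finite_strings_measure (mu : B -> nat) :
  (forall b c, g b = Some c -> mu c < mu b) -> finite_strings.
Proof.
move=> lt_mu b; have [k] := ubnP (mu b); elim: k b => // k IH b ltb.
case gb: (g b) => [c|]; last by exists 1.
have [j jE] := IH c (leq_trans (lt_mu _ _ gb) ltb).
by exists (j + 1); rewrite (@iter_opD _ _ 1 j b c).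
Qed.

Lemma string_length_None b : g b = None -> string_length g b = 0.
Proof.
move=> gb; have := @string_lengthP _ g b (ex_intro _ 1 gb) 1.
by rewrite /iter_op /= gb /=; case: string_length.
Qed.

Hypothesis fin : finite_strings.

Lemma string_length_Some b c : g b = Some c -> string_length g b = (string_length g c).+1.
Proof.
move=> gb; have lenP k : (k.+1 <= string_length g b) = (k <= string_length g c).
  rewrite -!string_lengthP //; do ?[exact: fin].
  by rewrite -addn1 (@iter_opD _ _ 1 k b c).
have := lenP (string_length g c); have := lenP (string_length g b).-1; lia.
Qed.

Definition iter_max k b : B := odflt b (iter_op g k b).

Lemma iter_maxS k b c : g b = Some c -> k <= string_length g c ->
  iter_max k.+1 b = iter_max k c.
Proof.
move=> gb; rewrite -string_lengthP; last exact: fin.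
rewrite /iter_max -addn1 (@iter_opD _ _ 1 k b c) //.
by case: (iter_op g k c).
Qed.

End Strings.

(** Finiteness of the strings makes the bounded maximum in [string_length] the true supremum. *)
Record seminormal (B : finType) (u : crystal_ops B) : Prop := Seminormal {
  lower_raise : forall b c, raise u b = Some c <-> lower u c = Some b;
  finite_raise : finite_strings (raise u);
  finite_lower : finite_strings (lower u) }.

Section SeminormalTheory.

Variables (B : finType) (u : crystal_ops B).
Hypothesis su : seminormal u.

Definition emax b : B := iter_max (raise u) (eps u b) b.

Lemma raise_Some b c : raise u b = Some c -> eps u b = (eps u c).+1 /\ phi u c = (phi u b).+1.
Proof.
move=> bc; split; first exact: (string_length_Some (finite_raise su) bc).
by apply: (string_length_Some (finite_lower su)); apply/(lower_raise su).
Qed.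

Lemma raise_None b : raise u b = None -> eps u b = 0.
Proof. exact: string_length_None. Qed.

Lemma lower_None b : lower u b = None -> phi u b = 0.
Proof. exact: string_length_None. Qed.

Lemma lower_Some b c : lower u b = Some c -> phi u b = (phi u c).+1 /\ eps u c = (eps u b).+1.
Proof. by move/(lower_raise su)/raise_Some => -[]. Qed.

Lemma emax_None b : raise u b = None -> emax b = b.
Proof. by move=> bE; rewrite /emax raise_None. Qed.

Lemma emax_Some b c : raise u b = Some c -> emax b = emax c.
Proof.
move=> bc; have [bE _] := raise_Some bc; rewrite /emax bE.
exact: (iter_maxS (finite_raise su) bc (leqnn _)).
Qed.

End SeminormalTheory.

Section Tensor.

Variables (B C : finType) (u : crystal_ops B) (v : crystal_ops C).
Hypotheses (su : seminormal u) (sv : seminormal v).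

Variant raise_spec b c : option (B * C) -> Type :=
| RaiseNone of eps u b <= phi v c & raise v c = None : raise_spec b c None
| RaiseRight c' of eps u b <= phi v c & raise v c = Some c' : raise_spec b c (Some (b, c'))
| RaiseLeft b' of phi v c < eps u b & raise u b = Some b' : raise_spec b c (Some (b', c)).

Lemma raiseP b c : raise_spec b c (raise (tensor u v) (b, c)).
Proof.
rewrite /=; case: leqP => [le|lt].
  by case cE: (raise v c) => [c'|] /=; constructor.
case bE: (raise u b) => [b'|] /=; first by constructor.
by rewrite (raise_None bE) in lt.
Qed.

Variant lower_spec b c : option (B * C) -> Type :=
| LowerNone of phi v c <= eps u b & lower u b = None : lower_spec b c None
| LowerRight c' of eps u b < phi v c & lower v c = Some c' : lower_spec b c (Some (b, c'))
| LowerLeft b' of phi v c <= eps u b & lower u b = Some b' : lower_spec b c (Some (b', c)).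

Lemma lowerP b c : lower_spec b c (lower (tensor u v) (b, c)).
Proof.
rewrite /=; case: leqP => [le|lt].
  by case bE: (lower u b) => [b'|] /=; constructor.
case cE: (lower v c) => [c'|] /=; first by constructor.
by rewrite (lower_None cE) in lt.
Qed.

Lemma seminormal_tensor : seminormal (tensor u v).
Proof.
split.
- case=> b c [b' c']; split.
    case: raiseP => // [c1 le cE|b1 lt bE] [<- <-] /=.
      have [_ ->] := raise_Some sv cE; rewrite ltnS le.
      by move/(lower_raise sv): cE => ->.
    have [bE' _] := raise_Some su bE; rewrite ltnNge -ltnS -bE' lt /=.
    by move/(lower_raise su): bE => ->.
  case: lowerP => // [c1 lt cE|b1 le bE] [<- <-] /=.
    have [cE' _] := lower_Some sv cE; rewrite -ltnS -cE' lt.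
    by move/(lower_raise sv): cE => ->.
  have [_ bE'] := lower_Some su bE; rewrite bE' leqNgt ltnS le /=.
  by move/(lower_raise su): bE => ->.
- apply: (@finite_strings_measure _ _ (fun p => eps u p.1 + eps v p.2)) => -[b c] p.
  case: raiseP => // [c1 le cE|b1 lt bE] [<-] /=.
    by have [-> _] := raise_Some sv cE; rewrite addnS.
  by have [-> _] := raise_Some su bE; rewrite addSn.
apply: (@finite_strings_measure _ _ (fun p => phi u p.1 + phi v p.2)) => -[b c] p.
case: lowerP => // [c1 le cE|b1 lt bE] [<-] /=.
  by have [-> _] := lower_Some sv cE; rewrite addnS.
by have [-> _] := lower_Some su bE; rewrite addSn.
Qed.

Lemma phi_tensor b c : phi (tensor u v) (b, c) = phi u b + (phi v c - eps u b).
Proof.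
have [k] := ubnP (phi u b + phi v c); elim: k b c => // k IH b c ltk.
case E: (lower (tensor u v) (b, c)) => [p|]; last first.
  rewrite (lower_None E); move: E; case: lowerP => // le bE _.
  by rewrite (lower_None bE); lia.
have [-> _] := lower_Some seminormal_tensor E.
move: E; case: lowerP => // [c1 le cE|b1 lt bE] [<-] /=.
  have [cE1 _] := lower_Some sv cE; rewrite IH; lia.
have [bE1 bE2] := lower_Some su bE; rewrite IH; lia.
Qed.

(** Raising acts on [b] until [eps] of it has come down to [phi] of [c], hence [eps u b - phi v c]
    times, and from then on only on [c], since raising [c] increases its [phi]. *)
Lemma emax_tensor b c :
  emax (tensor u v) (b, c) = (iter_max (raise u) (eps u b - phi v c) b, emax v c).
Proof.
have [k] := ubnP (eps u b + eps v c); elim: k b c => // k IH b c ltk.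
case E: (raise (tensor u v) (b, c)) => [p|]; last first.
  rewrite (emax_None E); move: E; case: raiseP => // le cE _.
  by rewrite (emax_None cE); move: le; rewrite -subn_eq0 => /eqP ->.
rewrite (emax_Some seminormal_tensor E).
move: E; case: raiseP => // [c1 le cE|b1 lt bE] [<-] /=.
  have [cE1 cE2] := raise_Some sv cE; rewrite IH; last by lia.
  rewrite (emax_Some sv cE); congr pair; move: (le); rewrite -subn_eq0 => /eqP ->.
  by have -> : eps u b - phi v c1 = 0 by lia.
have [bE1 _] := raise_Some su bE; rewrite IH; last by lia.
congr pair; rewrite bE1 subSn; last by lia.
by rewrite (iter_maxS (finite_raise su) bE) //; apply: leq_subr.
Qed.

End Tensor.

Section Transport.

Variables (B C : finType) (u : crystal_ops B) (w : crystal_ops C).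
Variables (join : B -> C) (split : C -> B).
Hypotheses (splitK : cancel split join) (joinK : cancel join split).
Hypothesis raiseE : forall c, raise w c = omap join (raise u (split c)).
Hypothesis lowerE : forall c, lower w c = omap join (lower u (split c)).
Hypothesis su : seminormal u.

(** [SVW_ops] splits a tuple into head and tail; the theory of tensor products is carried along this
    bijection. *)
Lemma seminormal_transport : seminormal w.
Proof.
have sub (g : B -> option B) (g' : C -> option C) :
    (forall c, g' c = omap join (g (split c))) -> finite_strings g -> finite_strings g'.
  move=> gE fin; apply: (@finite_strings_measure _ _ (string_length g \o split)) => b c /=.
  rewrite gE; case bE: (g (split b)) => [b'|] //= [<-].
  by rewrite (string_length_Some fin bE) joinK.
split; [|exact: (sub _ _ raiseE (finite_raise su))|exact: (sub _ _ lowerE (finite_lower su))].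
move=> b c; rewrite raiseE lowerE; split.
  case bE: (raise u (split b)) => [b'|] //= [<-]; rewrite joinK.
  by move/(lower_raise su): bE => -> /=; rewrite splitK.
case cE: (lower u (split c)) => [c'|] //= [<-]; rewrite joinK.
by move/(lower_raise su): cE => -> /=; rewrite splitK.
Qed.

Lemma phi_transport c : phi w c = phi u (split c).
Proof.
have [k] := ubnP (phi u (split c)); elim: k c => // k IH c ltk.
case E: (lower w c) => [c'|].
  have [-> _] := lower_Some seminormal_transport E; move: E; rewrite lowerE.
  case cE: (lower u (split c)) => [b|] //= [<-].
  have [cE1 _] := lower_Some su cE; rewrite IH joinK ?cE1 //; lia.
rewrite (lower_None E); move: E; rewrite lowerE.
by case cE: (lower u (split c)) => [b|] //= _; rewrite (lower_None cE).
Qed.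

Lemma emax_transport c : emax w c = join (emax u (split c)).
Proof.
have [k] := ubnP (eps u (split c)); elim: k c => // k IH c ltk.
case E: (raise w c) => [c'|].
  rewrite (emax_Some seminormal_transport E); move: E; rewrite raiseE.
  case cE: (raise u (split c)) => [b|] //= [<-].
  have [cE1 _] := raise_Some su cE; rewrite IH joinK; last by lia.
  by rewrite (emax_Some su cE).
rewrite (emax_None E); move: E; rewrite raiseE.
by case cE: (raise u (split c)) => [b|] //= _; rewrite (emax_None cE) splitK.
Qed.

End Transport.

(** * The crystal of subsets of the alphabet *)

Section Letters.

Variables (n : nat) (i : 'I_n.-1).
Implicit Type T : {set 'I_n}.

Lemma val_next_letter : val (next_letter i) = i.+1.
Proof. by rewrite /next_letter /= /bump leqnn. Qed.

Lemma letter_neq : (letter i == next_letter i) = false.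
Proof. by rewrite -val_eqE val_next_letter /= ltn_eqF. Qed.

Lemma raise_set T : raise (set_ops i) T =
  if next_letter i \in T then
    if letter i \in T then Some (T :\ next_letter i) else Some (letter i |: T)
  else None.
Proof.
rewrite /=; set a := letter i; set b := next_letter i.
have ab : (a == b) = false := letter_neq.
have memE x : (x \in T :&: [set a; b]) = (x \in T) && ((x == a) || (x == b)).
  by rewrite !inE.
case: eqP => [/setP E|nE].
  by have := E a; have := E b; rewrite !memE !inE !eqxx ab orbT !andbT => -> ->.
case: eqP => [/setP E|nE2].
  by have := E a; have := E b; rewrite !memE !inE !eqxx orbT !andbT => -> ->.
case bT: (b \in T) => //; case aT: (a \in T).
  case: nE2; apply/setP => x; rewrite memE !inE.
  by case: eqP => [->|_]; rewrite ?aT //=; case: eqP => [->|_]; rewrite ?bT ?andbF.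
case: nE; apply/setP => x; rewrite memE !inE.
by case: eqP => [->|_]; rewrite ?aT ?ab //=; case: eqP => [->|_]; rewrite ?bT ?andbF.
Qed.

Lemma lower_set T : lower (set_ops i) T =
  if letter i \in T then
    if next_letter i \in T then Some (T :\ letter i) else Some (next_letter i |: T)
  else None.
Proof.
rewrite /=; set a := letter i; set b := next_letter i.
have ab : (a == b) = false := letter_neq.
have memE x : (x \in T :&: [set a; b]) = (x \in T) && ((x == a) || (x == b)).
  by rewrite !inE.
case: eqP => [/setP E|nE].
  have := E a; have := E b; rewrite !memE !inE !eqxx (eq_sym b a) ab orbT !andbT.
  by move=> -> ->.
case: eqP => [/setP E|nE2].
  by have := E a; have := E b; rewrite !memE !inE !eqxx orbT !andbT => -> ->.
case aT: (a \in T) => //; case bT: (b \in T).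
  case: nE2; apply/setP => x; rewrite memE !inE.
  by case: eqP => [->|_]; rewrite ?aT //=; case: eqP => [->|_]; rewrite ?bT ?andbF.
case: nE; apply/setP => x; rewrite memE !inE.
by case: eqP => [->|_]; rewrite ?aT ?ab //=; case: eqP => [->|_]; rewrite ?bT ?andbF.
Qed.

Lemma seminormal_set : seminormal (set_ops i).
Proof.
have ab := letter_neq; have ba : (next_letter i == letter i) = false.
  by rewrite eq_sym.
split.
- move=> T U; rewrite raise_set lower_set; set a := letter i in ab ba *.
  set b := next_letter i in ab ba *; split.
    case bT: (b \in T) => //; case aT: (a \in T) => -[<-]; rewrite !inE ?eqxx ?ab ?ba.
      rewrite aT /=; congr Some; apply/setP => x; rewrite !inE.
      by case: (eqVneq x b) => [->|].
    rewrite bT /=; congr Some; apply/setP => x; rewrite !inE.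
    by case: (eqVneq x a) => [->|].
  case aU: (a \in U) => //; case bU: (b \in U) => -[<-]; rewrite !inE ?eqxx ?ab ?ba.
    rewrite bU /=; congr Some; apply/setP => x; rewrite !inE.
    by case: (eqVneq x a) => [->|].
  rewrite aU /=; congr Some; apply/setP => x; rewrite !inE.
  by case: (eqVneq x b) => [->|].
- apply: (@finite_strings_measure _ _ (fun T =>
    (next_letter i \in T) * (2 - (letter i \in T)))) => T U.
  rewrite raise_set; case bT: (_ \in _) => //; case aT: (_ \in _) => -[<-];
    by rewrite !inE ?eqxx ?ab ?ba ?aT ?bT.
apply: (@finite_strings_measure _ _ (fun T =>
  (letter i \in T) * (2 - (next_letter i \in T)))) => T U.
rewrite lower_set; case aT: (_ \in _) => //; case bT: (_ \in _) => -[<-];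
  by rewrite !inE ?eqxx ?ab ?ba ?aT ?bT.
Qed.

Lemma eps_set T : eps (set_ops i) T = (next_letter i \in T) * (2 - (letter i \in T)).
Proof.
have ab := letter_neq; have ba : (next_letter i == letter i) = false.
  by rewrite eq_sym.
have sS := seminormal_set.
have e1 (U : {set 'I_n}) : next_letter i \in U -> letter i \in U -> eps (set_ops i) U = 1.
  move=> bU aU; have := raise_set U; rewrite bU aU => /(raise_Some sS)[-> _].
  by rewrite raise_None // raise_set !inE eqxx.
case bT: (_ \in _); last by rewrite raise_None // raise_set bT.
case aT: (_ \in _); first by rewrite e1.
have := raise_set T; rewrite bT aT => /(raise_Some sS)[-> _].
by rewrite e1 // !inE ?eqxx // bT orbT.
Qed.

Lemma phi_set T : phi (set_ops i) T = (letter i \in T) * (2 - (next_letter i \in T)).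
Proof.
have ab := letter_neq; have ba : (next_letter i == letter i) = false.
  by rewrite eq_sym.
have sS := seminormal_set.
have e1 (U : {set 'I_n}) : next_letter i \in U -> letter i \in U -> phi (set_ops i) U = 1.
  move=> bU aU; have := lower_set U; rewrite bU aU => /(lower_Some sS)[-> _].
  by rewrite lower_None // lower_set !inE eqxx.
case aT: (_ \in _); last by rewrite lower_None // lower_set aT.
case bT: (_ \in _); first by rewrite e1.
have := lower_set T; rewrite bT aT => /(lower_Some sS)[-> _].
by rewrite e1 // !inE ?eqxx // aT orbT.
Qed.

(** The string has at most three members, so raising that stops [d] steps before its end is checked
    directly. *)
Lemma mem_iter_max T d x : (x \in iter_max (raise (set_ops i)) (eps (set_ops i) T - d) T) =
  if x == letter i then up_bit d (letter i \in T) (next_letter i \in T)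
  else if x == next_letter i then down_bit d (next_letter i \in T) else x \in T.
Proof.
rewrite eps_set /up_bit /down_bit; set a := letter i; set b := next_letter i.
have ab : (a == b) = false := letter_neq.
have ba : (b == a) = false by rewrite eq_sym.
have it0 j : j = 0 -> (x \in iter_max (raise (set_ops i)) j T) =
    if x == a then a \in T else if x == b then b \in T else x \in T.
  by move=> ->; case: eqP => [->//|_]; case: eqP => [->|].
have it1 j : j = 1 -> iter_max (raise (set_ops i)) j T = odflt T (raise (set_ops i) T).
  by move=> ->.
have it2 j : j = 2 -> iter_max (raise (set_ops i)) j T =
  odflt T (obind (raise (set_ops i)) (raise (set_ops i) T)) by move=> ->.
case bT: (b \in T); case aT: (a \in T); rewrite ?aT ?bT in it0 *.
- case: d => [|d]; last by rewrite [LHS]it0 //=; lia.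
  rewrite it1 // raise_set -/a -/b aT bT /= !inE.
  by case: (eqVneq x a) => [->|_]; rewrite ?ab ?aT //=; case: eqP.
- case: d => [|[|d]]; last by rewrite [LHS]it0 //=; lia.
    rewrite it2 // raise_set -/a -/b aT bT.
    rewrite -[obind _ _]/(raise (set_ops i) (a |: T)) raise_set -/a -/b.
    rewrite !inE eqxx ba bT /= !inE.
    by case: (eqVneq x a) => [->|_]; rewrite ?ab //=; case: eqP.
  rewrite it1 // raise_set -/a -/b aT bT /= !inE.
  by case: eqP => //= _; case: eqP => [->|].
- by rewrite [LHS]it0 //=; lia.
by rewrite [LHS]it0 //=; lia.
Qed.

End Letters.

(** * Set-valued words as fillings *)

Definition mem_row n (T : {set 'I_n}) (r : nat) : bool :=
  if insub r is Some a then a \in T else false.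

Lemma mem_row_val n (T : {set 'I_n}) (a : 'I_n) : mem_row T a = (a \in T).
Proof. by rewrite /mem_row valK. Qed.

Lemma mem_row_out n (T : {set 'I_n}) r : n <= r -> mem_row T r = false.
Proof. by move=> le; rewrite /mem_row insubF // ltnNge le. Qed.

(** The head of the tuple carries the largest value [m]. Removing it restricts the filling to
    smaller values, so the right tensor factor holds exactly what the transducer has read before. *)
Definition fill n m (S : SVW n m) : filling :=
  fun v r => (0 < v <= m) && mem_row (nth set0 S (m - v)) r.

Fixpoint row_phi (h : filling) i v : nat :=
  if v is v'.+1 then next_phi (row_phi h i v') (h v i) (h v i.+1) else 0.

Definition row_E (h : filling) i : filling := fun v r =>
  if r == i then up_bit (row_phi h i v.-1) (h v i) (h v i.+1)
  else if r == i.+1 then down_bit (row_phi h i v.-1) (h v i.+1) else h v r.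

Lemma eq_row_phi h1 h2 i v : (forall u r, 0 < u <= v -> h1 u r = h2 u r) ->
  row_phi h1 i v = row_phi h2 i v.
Proof.
elim: v => //= v IH eqh; rewrite !eqh ?leqnn // IH // => u r /andP[u0 le].
by apply: eqh; rewrite u0 leqW.
Qed.

Section SetValuedWords.

Variable n : nat.
Implicit Type i : 'I_n.-1.

Lemma fill_behead m (S : SVW n m.+1) v r : v <= m ->
  fill S v r = fill (behead_tuple S) v r.
Proof.
move=> le; rewrite /fill le leqW // !andbT; congr andb.
by rewrite nth_behead subSn.
Qed.

Lemma fill_thead m (S : SVW n m.+1) r : fill S m.+1 r = mem_row (thead S) r.
Proof. by rewrite /fill ltn0Sn leqnn subnn /thead (tnth_nth set0). Qed.

Lemma fill_cons m T (S : SVW n m) v r : v <= m ->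
  fill (cons_tuple T S : SVW n m.+1) v r = fill S v r.
Proof. by move=> le; rewrite /fill le leqW // subSn. Qed.

Lemma fill_cons_max m T (S : SVW n m) r :
  fill (cons_tuple T S : SVW n m.+1) m.+1 r = mem_row T r.
Proof. by rewrite /fill leqnn subnn. Qed.

Lemma SVW_splitK m : cancel (fun S : SVW n m.+1 => (thead S, behead_tuple S) :
    {set 'I_n} * SVW n m) (fun p => cons_tuple p.1 p.2).
Proof. by move=> S /=; rewrite [RHS]tuple_eta. Qed.

Lemma SVW_joinK m : cancel (fun p : {set 'I_n} * SVW n m => cons_tuple p.1 p.2 : SVW n m.+1)
  (fun S => (thead S, behead_tuple S)).
Proof. by case=> T S; congr pair; apply: val_inj. Qed.

Lemma seminormal_SVW i m : seminormal (SVW_ops i m).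
Proof.
elim: m => [|m IH]; first by split=> // b; exists 1.
apply: (seminormal_transport (@SVW_splitK m) (@SVW_joinK m)) => //.
exact: seminormal_tensor (seminormal_set i) IH.
Qed.

Lemma phi_SVW i m (S : SVW n m) : phi (SVW_ops i m) S = row_phi (fill S) i m.
Proof.
elim: m S => [|m IH] S; first by rewrite lower_None.
have -> : phi (SVW_ops i m.+1) S =
    phi (tensor (set_ops i) (SVW_ops i m)) (thead S, behead_tuple S).
  apply: (phi_transport (@SVW_splitK m) (@SVW_joinK m)) => //.
  exact: seminormal_tensor (seminormal_set i) (seminormal_SVW i m).
rewrite phi_tensor; [|exact: seminormal_set|exact: seminormal_SVW].
rewrite IH phi_set eps_set /= !fill_thead -[nat_of_ord i]/(val (letter i)).
rewrite -[(val (letter i)).+1]val_next_letter !mem_row_val.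
have -> : row_phi (fill S) (letter i) m = row_phi (fill (behead_tuple S)) (letter i) m.
  by apply: eq_row_phi => u r /andP[_ le]; apply: fill_behead.
by rewrite /next_phi; case: (letter i \in _); case: (next_letter i \in _) => /=; lia.
Qed.

Lemma fill_E i m (S : SVW n m) v r : 0 < v <= m -> fill (E i S) v r = row_E (fill S) i v r.
Proof.
rewrite -[E i S]/(emax (SVW_ops i m) S); elim: m S v => [|m IH] S v; first by lia.
have sm := seminormal_SVW i m; have ss := seminormal_set i.
have -> : emax (SVW_ops i m.+1) S =
    (fun p => cons_tuple p.1 p.2 : SVW n m.+1)
      (emax (tensor (set_ops i) (SVW_ops i m)) (thead S, behead_tuple S)).
  apply: (emax_transport (@SVW_splitK m) (@SVW_joinK m)) => //.
  exact: seminormal_tensor.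
rewrite emax_tensor //; case/andP=> v_gt0; rewrite leq_eqVlt => /orP[/eqP ->|]; last first.
  rewrite ltnS => le; rewrite fill_cons // IH ?v_gt0 // /row_E !(fill_behead S) //.
  suff -> : row_phi (fill S) i v.-1 = row_phi (fill (behead_tuple S)) i v.-1 by [].
  by apply: eq_row_phi => u q /andP[_ leu]; apply: fill_behead; lia.
rewrite fill_cons_max phi_SVW /row_E /= !fill_thead.
have -> : row_phi (fill S) i m = row_phi (fill (behead_tuple S)) i m.
  by apply: eq_row_phi => u q /andP[_ leu]; apply: fill_behead.
set d := row_phi _ _ _; rewrite -val_next_letter -[nat_of_ord i]/(val (letter i)).
rewrite !mem_row_val; have [ltr|ler] := ltnP r n; last first.
  rewrite !mem_row_out // !gtn_eqF //; apply: leq_trans ler; exact: ltn_ord.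
rewrite -[r]/(val (Ordinal ltr)) !mem_row_val mem_iter_max !val_eqE.
by [].
Qed.

End SetValuedWords.

(** * Rectification *)

Lemma row_phiS h i v : row_phi h i v.+1 =
  next_phi (row_phi h i v) (h v.+1 i) (h v.+1 i.+1).
Proof. by []. Qed.

Lemma pass_pred al D k b j : j < k ->
  pass al D k b j = up_bit (D j.+1) (al j) (pass al D k b j.+1).
Proof. by move=> lt; rewrite (pass_cat _ _ _ (leqnSn j) lt) passS // pass_id. Qed.

(** The operators of index [j] to [k - 1] have acted, the last one first. Row [j] still awaits the
    operator of index [j - 1], so it shows the intermediate bit [pass], while the rows below it are
    final. *)
Lemma row_E_foldr h k j v r : j <= k ->
  foldr (fun (i : nat) g => row_E g i) h (iota j (k - j)) v.+1 r =
  if r < j then h v.+1 r else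
  if r == j then pass (h v.+1) (chain_phi h k v) k (h v.+1 k) j
  else if r <= k then chain h k v.+1 r else h v.+1 r.
Proof.
move=> lejk; have [d dE] : exists d, d = k - j by exists (k - j).
elim: d j v r lejk dE => [|d IH] j v r lejk dE.
  have -> : j = k by lia.
  by rewrite subnn /= pass_id; case: ltngtP => // ->.
have ltjk : j < k by lia.
have -> : k - j = (k - j.+1).+1 by lia.
rewrite [foldr _ _ _]/=; set g := foldr _ _ _.
have {}IH u q := IH j.+1 u q ltjk; have {}IH u q := IH u q ltac:(lia); rewrite -/g in IH.
have phiE u : row_phi g j u = chain_phi h k u j.+1.
  elim: u => // u IHu; rewrite row_phiS IHu chain_phiS /pass_phi !IH ltnSn.
  by rewrite ltnn eqxx.
rewrite /row_E phiE !IH ltnSn ltnn eqxx; case: (ltngtP r j) => [ltr|ltr|rE].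
- by rewrite ltn_eqF ?ltnS ?(ltnW ltr) // ltnW.
- case: (eqVneq r j.+1) => [->|nr].
    by rewrite ltjk chainS ltjk /pass_bit.
  by rewrite ifF //; lia.
by rewrite [RHS]pass_pred.
Qed.

Lemma row_E_chain h k v r :
  foldr (fun (i : nat) g => row_E g i) h (iota 0 k) v.+1 r =
  if r <= k then chain h k v.+1 r else h v.+1 r.
Proof.
rewrite -{1}[k]subn0 row_E_foldr //=; case: r => [|r] //=.
Qed.

Lemma eq_row_E h1 h2 i v r : 0 < v ->
  (forall u q, 0 < u <= v -> h1 u q = h2 u q) -> row_E h1 i v r = row_E h2 i v r.
Proof.
move=> v_gt0 eqh; rewrite /row_E !eqh ?v_gt0 ?leqnn //.
rewrite (@eq_row_phi h1 h2) // => u q /andP[u0 le]; apply: eqh; rewrite u0; lia.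
Qed.

Lemma row_filter f v r : row f v r = [seq u <- iota 1 v | f u r].
Proof.
elim: v => // v IH; rewrite -[in RHS](addn1 v) iotaD filter_cat -IH /= add1n.
by case: (f v.+1 r); rewrite ?cats1 ?cats0.
Qed.

Lemma sorted_row f v r : sorted leq (row f v r).
Proof. by rewrite row_filter; apply: (sorted_filter leq_trans); apply: iota_sorted. Qed.

Lemma filter_iota_le k N : k < N -> [seq x <- iota 0 N | x <= k] = iota 0 k.+1.
Proof.
move=> ltkN; rewrite -(subnK ltkN) addnC iotaD filter_cat.
rewrite (_ : [seq x <- iota 0 k.+1 | x <= k] = iota 0 k.+1).
  rewrite (_ : [seq x <- iota (0 + k.+1) _ | x <= k] = [::]) ?cats0 //.
  apply/eqP; rewrite -(negbK (_ == _)) -has_filter; apply/negP => /hasP[x].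
  rewrite mem_iota; lia.
by apply/all_filterP/allP => x; rewrite mem_iota.
Qed.

Section Words.

Variables (n m : nat).
Implicit Type S : SVW n m.

Lemma fill_foldr_E S (l : seq 'I_n.-1) v r : 0 < v <= m ->
  fill (foldr (@E n m) S l) v r =
  foldr (fun (i : nat) g => row_E g i) (fill S) (map val l) v r.
Proof.
elim: l v r => //= i l IH v r vm; rewrite fill_E //.
apply: eq_row_E => [|u q /andP[u0 leu]]; first by case/andP: vm.
by apply: IH; lia.
Qed.

Lemma fill_E_block S (k : 'I_n.-1) v r : 0 < v <= m ->
  fill (E_block k S) v r =
  if r <= k.+1 then chain (fill S) k.+1 v r else fill S v r.
Proof.
move=> vm; rewrite /E_block fill_foldr_E //.
have -> : map val [seq i : 'I_n.-1 <- enum 'I_n.-1 | i <= k] = iota 0 k.+1.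
  rewrite -(filter_map val (fun x => x <= k)) val_enum_ord filter_iota_le //.
by case: v vm => // v _; rewrite row_E_chain.
Qed.

Lemma fill_sub S (j : 'I_m) (a : 'I_n) : fill S (m - j) a = (a \in tnth S j).
Proof.
have lt := ltn_ord j; rewrite /fill subKn ?(ltnW lt) // mem_row_val (tnth_nth set0).
by rewrite subn_gt0 lt leq_subr.
Qed.

Lemma row_wordE S (a : 'I_n) : row_word S a = [seq u <- rev (iota 1 m) | fill S u a].
Proof.
have -> : rev (iota 1 m) = [seq m - (j : nat) | j : 'I_m <- enum 'I_m].
  rewrite (map_comp (fun j => m - j) val) val_enum_ord.
  apply: (@eq_from_nth _ 0) => [|j]; rewrite size_rev !size_iota ?size_map ?size_iota //.
  move=> ltj; rewrite nth_rev ?size_iota // nth_iota; last by lia.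
  by rewrite (nth_map 0) ?size_iota // nth_iota //; lia.
rewrite filter_map /row_word; congr map; apply: eq_filter => j /=.
by rewrite fill_sub.
Qed.

Lemma sort_row_word S (a : 'I_n) : sort leq (row_word S a) = row (fill S) m a.
Proof.
apply: (sorted_eq leq_trans anti_leq); first exact: (sort_sorted leq_total).
  exact: sorted_row.
by rewrite perm_sort row_wordE row_filter filter_rev perm_rev.
Qed.

End Words.

(** * Adding one row to a rectified tableau *)

Definition with_row f k (b : nat -> bool) : filling :=
  fun v r => if r < k then f v r else (r == k) && b v.

Record represents m (T : seq (seq nat)) f : Prop := Represents {
  rep_incr : increasing_tableau T;
  rep_col : nth [::] T =1 col f m;
  rep_tab : is_tab f m }.

Lemma eq_is_tab f g m : (forall u r, 0 < u <= m -> f u r = g u r) ->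
  is_tab f m -> is_tab g m.
Proof.
move=> fg tf u r ltu; have fg' v q : 0 < v <= u -> f v q = g v q.
  by case/andP=> v0 lev; apply: fg; rewrite v0; lia.
by rewrite -fg // -!(eq_cnt fg'); apply: tf.
Qed.

Lemma eq_represents m T f g : (forall u r, 0 < u <= m -> f u r = g u r) ->
  represents m T f -> represents m T g.
Proof.
move=> fg [iT cT tf]; split=> //; first by move=> c; rewrite cT (eq_col fg).
exact: eq_is_tab tf.
Qed.

(** Row [k] is filled from its largest letter downwards: [h t] keeps only the letters above [t], so
    each new letter is smaller than those present, as [chain_add_letter] requires. For [t = m] the
    row is empty and the chain returns [f]. *)
Lemma represents_row m T f k (b : nat -> bool) :
  (forall v r, k <= r -> ~~ f v r) -> represents m T f ->
  represents m (foldl hecke_insert T [seq u <- rev (iota 1 m) | b u])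
    (chain (with_row f k b) k).
Proof.
move=> fk repT.
pose h t := with_row f k (fun v => b v && (t < v)).
have tabh t : tab_rows (h t) k m.
  move=> u r ltu ltr; have hE q : q < k -> cnt (h t) u q = cnt f u q.
    by move=> ltq; elim: u {ltu} => // u IH; rewrite !cntS IH /h /with_row ltq.
  rewrite !hE ?(ltnW ltr) // /h /with_row ltr; apply: (rep_tab repT) => //.
have emp t v : v <= t -> ~~ h t v k by move=> le; rewrite /h /with_row ltnn eqxx ltnNge le andbF.
have cnt0 t v : v <= t -> cnt (h t) v k = 0.
  by elim: v => // v IH lt; rewrite cntS IH ?(ltnW lt) // (negPf (emp _ _ lt)).
suff main t : t <= m -> represents m
    (foldl hecke_insert T [seq u <- rev (iota t.+1 (m - t)) | b u]) (chain (h t) k).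
  have := main 0 (leq0n m); rewrite subn0; apply: eq_represents => u r /andP[u0 _].
  by apply: eq_chain => v q /andP[v0 _] _; rewrite /h /with_row v0 andbT.
move=> letm; have [d dE] : exists d, d = m - t by exists (m - t).
elim: d t letm dE => [|d IH] t letm dE.
  have -> : t = m by lia.
  rewrite subnn /=; apply: eq_represents repT => u r /andP[u0 leum].
  have [ler|ltr] := leqP r k; last first.
    by case: u u0 {leum} => // u _; rewrite chainS leqNgt ltr (negPf (fk _ _ (ltnW ltr))).
  have [_ ->] // := settled_empty (tabh m) (leqnn m) (@emp m) leum.
  rewrite /h /with_row [m < u]ltnNge leum !andbF; case: ltnP => // lekr.
  by rewrite (negPf (fk _ _ lekr)).
have lttm : t < m by lia.
have -> : m - t = (m - t.+1).+1 by lia.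
have [|iT cT tT] := IH t.+1 lttm; first by lia.
rewrite /= rev_cons filter_rcons; have [bt|nbt] := boolP (b t.+1); last first.
  apply: eq_represents (Represents iT cT tT) => u r _; apply: eq_chain => v q _ _.
  rewrite /h /with_row; case: (q < k) => //; congr andb.
  by rewrite [t.+1 < v]ltn_neqAle; case: eqP => [<-|//]; rewrite (negPf nbt).
rewrite foldl_rcons; set T1 := foldl _ _ _ in iT cT *.
have [[_ cst] _] := settled_empty (tabh t.+1) lttm (@emp t.+1) (leqnSn t).
have [_ bits] := settled_empty (tabh t.+1) lttm (@emp t.+1) (leqnn t.+1).
have [||iT' cT' tT'] := @hecke_insert_col T1 (chain (h t.+1) k) k t m iT cT tT _ _ lttm.
- by rewrite cst // cnt0.
- by rewrite bits // emp.
apply: eq_represents (Represents iT' cT' tT') => u r um.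
rewrite -(chain_add_letter (tabh t.+1) lttm (@emp t.+1)) //.
apply: eq_chain => v q _ _; rewrite /add_letter /h /with_row.
case: ltngtP => //= _; rewrite ?andbF ?orbF ?andbT //.
by rewrite [t.+1 < v]ltn_neqAle; case: (eqVneq v t.+1) => [->|]; rewrite ?bt ?ltnS ?leqnn ?orbF // eq_sym => ->.
Qed.

Section Rectification.

Variables (n m : nat) (S : SVW n m).

Definition letters r : seq nat := [seq u <- rev (iota 1 m) | fill S u r].

Definition hecke_rows k : seq (seq nat) :=
  foldl hecke_insert [::] (flatten [seq letters r | r <- iota 0 k]).

Lemma hecke_rowsS k : hecke_rows k.+1 = foldl hecke_insert (hecke_rows k) (letters k).
Proof.
by rewrite /hecke_rows -addn1 iotaD map_cat flatten_cat foldl_cat /= cats0.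
Qed.

Lemma chain_out h k v r : k < r -> ~~ chain h k v r.
Proof. by case: v => // v lt; rewrite chainS leqNgt lt. Qed.

Definition rect_prefix (l : seq 'I_n.-1) : SVW n m := foldl (fun U k => E_block k U) S l.

(** The first [j] blocks involve only rows 0 to [j], so the next row still holds the letters of [S]
    when the next block reads it. *)
Lemma represents_rect_prefix l : map val l = iota 0 (size l) ->
  exists f, [/\ represents m (hecke_rows (size l).+1) f,
    forall v r, size l < r -> ~~ f v r &
    forall v r, 0 < v <= m ->
      fill (rect_prefix l) v r = if r <= size l then f v r else fill S v r].
Proof.
elim/last_ind: l => [|l k IH].
  move=> _; pose f0 : filling := fun _ _ => false.
  (* A chain with no operators: the first row is added to the empty filling, so the base case is
     also an instance of [represents_row]. *)
  exists (chain (with_row f0 0 (fun u => fill S u 0)) 0); split.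
  - rewrite hecke_rowsS; apply: represents_row => //; split=> //.
      by move=> c; rewrite nth_nil; elim: m => //= u <-.
  - by move=> v r; apply: chain_out.
  by case=> [|v] [|r] // _; rewrite chainS.
rewrite size_rcons map_rcons -[in iota _ _]addn1 iotaD add0n /= cats1.
move=> /rcons_inj[lE kE]; have [f [repf fout fE]] := IH lE.
set j := size l in kE lE fout fE repf *.
exists (chain (with_row f j.+1 (fun u => fill S u j.+1)) j.+1); split.
- by rewrite hecke_rowsS; apply: represents_row.
- by move=> v r; apply: chain_out.
move=> v r vm; rewrite /rect_prefix foldl_rcons fill_E_block // -/(rect_prefix l).
rewrite kE; case: leqP => lerj; last first.
  by rewrite fE // leqNgt ltnW.
apply: eq_chain => u q um leq; rewrite fE /with_row; last by lia.
rewrite ltnS; case: leqP => // ltq; have -> : q = j.+1 by lia.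
by rewrite eqxx.
Qed.

End Rectification.

Theorem theorem3p11 (n m : nat) (S : SVW n m) :
  P_hecke S =2 tab (rect S).
Proof.
move=> r c; have wordE : hecke_word S = flatten [seq letters S q | q <- iota 0 n].
  rewrite /hecke_word -val_enum_ord -map_comp; congr flatten.
  by apply: eq_map => a /=; rewrite row_wordE.
have rowsE : [seq sort leq (row_word (rect S) a) | a <- enum 'I_n] =
    [seq row (fill (rect S)) m q | q <- iota 0 n].
  by rewrite -val_enum_ord -map_comp; apply: eq_map => a /=; rewrite sort_row_word.
rewrite /P_hecke /tab wordE rowsE -/(hecke_rows S n).
case: n S {wordE rowsE} => [|n'] S; first by rewrite /= !nth_nil !onth0n.
have lE : map val (enum 'I_n'.+1.-1) = iota 0 (size (enum 'I_n'.+1.-1)).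
  by rewrite val_enum_ord size_enum_ord.
have [f [[_ colE tabf] fout fE]] := represents_rect_prefix S lE.
rewrite size_enum_ord /= in colE fout fE.
rewrite colE onth_col //; have [ltr|ler] := ltnP r n'.+1.
  rewrite (nth_map 0) ?size_iota // nth_iota // add0n; congr onth.
  rewrite !row_filter; apply: eq_in_filter => u; rewrite mem_iota => /andP[u0 leu].
  rewrite -[rect S]/(rect_prefix S (enum 'I_n'.+1.-1)) fE; last by rewrite u0.
  by rewrite -ltnS ltr.
rewrite [in RHS]nth_default ?size_map ?size_iota // row_filter.
rewrite (eq_filter (a2 := pred0)) ?filter_pred0 // => u.
by rewrite (negPf (fout u r ler)).
Qed.
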